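(* Let $R$ be a commutative ring, and let $\cdots\xrightarrow{\alpha}L\xrightarrow{\beta}L\xrightarrow{\alpha}L\xrightarrow{\beta}\cdots$ be an exact sequence of $R$-modules (that is, $\alpha,\beta$ are endomorphisms of an $R$-module $L$ with $\operatorname{Im}\alpha=\operatorname{Ker}\beta$ and $\operatorname{Im}\beta=\operatorname{Ker}\alpha$). Let $x\in R$ be an $L$-regular element such that $\beta(L)\subseteq Z:=\alpha(L)+xL$. Let $M$ be an $R$-module with $Z\subseteq M\subseteq L$, and set $N=\beta(M)+xZ$. (1) The sequence $$0\to Z\xrightarrow{\left(\begin{smallmatrix}\theta\\ \eta\end{smallmatrix}\right)}M\oplus Z\xrightarrow{\left(\begin{smallmatrix}\beta&-x\end{smallmatrix}\right)}N\to 0$$ is exact, where $\theta:Z\to M$ is the inclusion map and $\eta:Z\to Z$ is the (well-defined) map given by $\eta(\alpha(s)+xt)=\beta(t)$ for $s,t\in L$. (2) Suppose that $R$ is noetherian and contains a field $k$, that $Z$ and $M$ are finitely generated, and that $\beta$ is nilpotent. Then $M$ degenerates to $N$. (3) Assume that $R$ is noetherian. If $L$ and $M$ are Cohen-Macaulay, then so are $Z$ and $N$.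
   Context: Degeneration: let $R$ be a noetherian algebra over a field $k$ and let $M,N$ be finitely generated $R$-modules. We say that $M$ degenerates to $N$ if there exist a discrete valuation ring $V$ that is a $k$-algebra, with maximal ideal $tV$ and residue field $k$, and a finitely generated $R\otimes_k V$-module $Q$ such that $Q$ is flat as a $V$-module, $Q/tQ\cong N$ as $R$-modules, and $Q_t\cong M\otimes_k V_t$ as $R\otimes_k V_t$-modules (subscript $t$ denotes inverting $t$). Cohen-Macaulay means maximal Cohen-Macaulay: a finitely generated module $M$ over a commutative noetherian ring $R$ is Cohen-Macaulay if $\operatorname{depth}_{R_{\mathfrak p}}M_{\mathfrak p}\ge\dim R_{\mathfrak p}$ for all prime ideals $\mathfrak p$ of $R$ (the zero module has depth $\infty$). *)

(* Defs.v *)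
From HB Require Import structures.
From mathcomp Require Import all_boot all_algebra.
From mathcomp Require Import boolp.
From mathcomp Require Import ring.

Set Implicit Arguments.
Unset Strict Implicit.
Unset Printing Implicit Defensive.

Import GRing.Theory.

Local Open Scope ring_scope.
Local Open Scope quotient_scope.

(* Rings are [comPzRingType]s, hence possibly trivial; in particular the
   localizations below need no nontriviality proof. *)

Fact additive_zmod_morphism (U V : zmodType) (f : U -> V) :
  {morph f : x y / x + y} -> zmod_morphism f.
Proof. by move=> fD x y; apply: (addIr (f y)); rewrite -fD !subrK. Qed.

Definition isomorphic (A : pzRingType) (M N : lmodType A) : Prop :=
  exists f : {linear M -> N}, bijective f.

Definition short_exact (A : pzRingType) (M' M M'' : lmodType A)
    (f : {linear M' -> M}) (g : {linear M -> M''}) : Prop :=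
  [/\ injective f,
      forall m, g m = 0 <-> exists m', f m' = m &
      forall m'', exists m, g m = m''].

Definition finitely_generated (A : pzRingType) (M : lmodType A) : Prop :=
  exists n (g : 'I_n -> M), forall m, exists a : 'I_n -> A,
    m = \sum_(i < n) a i *: g i.

Section Submodule.
Variables (A : pzRingType) (M : lmodType A) (S : submodClosed M).

Record submod := Submod { submod_val : M; submodP : submod_val \in S }.

HB.instance Definition _ := [isSub for submod_val].
HB.instance Definition _ := [Choice of submod by <:].
HB.instance Definition _ := [SubChoice_isSubLmodule of submod by <:].

End Submodule.

Section QuotientModule.
Variables (A : pzRingType) (M : lmodType A) (S : submodClosed M).

Definition quotmod_pred : {pred M} := S.

Fact quotmod_pred_closed : zmod_closed quotmod_pred.
Proof.
split=> [|u v uS vS]; first exact: (rpred0 S).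
by apply: (rpredD (S := S)) => //; rewrite -scaleN1r; exact: (rpredZ (s := S)).
Qed.

HB.instance Definition _ :=
  GRing.isZmodClosed.Build M quotmod_pred quotmod_pred_closed.

Definition quotmod := Quotient.quot quotmod_pred.

HB.instance Definition _ := GRing.Zmodule.on quotmod.

Definition quotmod_pi (m : M) : quotmod := \pi_(Quotient.quot quotmod_pred) m.

Definition quotmod_scale (a : A) (y : quotmod) : quotmod :=
  quotmod_pi (a *: repr y).

Fact quotmod_pi_eq (m n : M) : m - n \in S -> quotmod_pi m = quotmod_pi n.
Proof. by move=> mnS; apply/eqP; rewrite -Quotient.idealrBE. Qed.

Fact quotmod_scale_pi a m : quotmod_scale a (quotmod_pi m) = quotmod_pi (a *: m).
Proof.
apply: quotmod_pi_eq; rewrite -scalerBr; apply: (rpredZ (s := S)).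
change (repr (quotmod_pi m) - m \in quotmod_pred).
by rewrite Quotient.idealrBE reprK.
Qed.

Fact quotmod_piD m n : quotmod_pi (m + n) = quotmod_pi m + quotmod_pi n.
Proof. exact: raddfD. Qed.

Fact quotmod_piP (y : quotmod) : exists m, y = quotmod_pi m.
Proof. by exists (repr y); rewrite /quotmod_pi reprK. Qed.

Fact quotmod_scaleA a b y :
  quotmod_scale a (quotmod_scale b y) = quotmod_scale (a * b) y.
Proof. by have [m ->] := quotmod_piP y; rewrite !quotmod_scale_pi scalerA. Qed.

Fact quotmod_scale1 : left_id 1 quotmod_scale.
Proof. by move=> y; have [m ->] := quotmod_piP y; rewrite quotmod_scale_pi scale1r. Qed.

Fact quotmod_scaleDr : right_distributive quotmod_scale +%R.
Proof.
move=> a y z; have [m ->] := quotmod_piP y; have [n ->] := quotmod_piP z.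
by rewrite -quotmod_piD !quotmod_scale_pi scalerDr quotmod_piD.
Qed.

Fact quotmod_scaleDl y : {morph quotmod_scale^~ y : a b / a + b}.
Proof.
move=> a b /=; have [m ->] := quotmod_piP y.
by rewrite !quotmod_scale_pi scalerDl quotmod_piD.
Qed.

HB.instance Definition _ := GRing.Zmodule_isLmodule.Build A quotmod
  quotmod_scaleA quotmod_scale1 quotmod_scaleDr quotmod_scaleDl.

End QuotientModule.

Section MultipleSubmodule.
Variables (A : comPzRingType) (a : A) (M : lmodType A).

Definition multiples : {pred M} := [pred m | `[< exists n, m = a *: n >]].

Fact multiples_closed : submod_closed multiples.
Proof.
split=> [|b u v]; first by apply/asboolP; exists 0; rewrite scaler0.
move=> /asboolP[m ->] /asboolP[n ->]; apply/asboolP; exists (b *: m + n).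
by rewrite scalerDr !scalerA mulrC.
Qed.

HB.instance Definition _ := GRing.isSubmodClosed.Build A M multiples
  (GRing.submod_closed_semi multiples_closed).

End MultipleSubmodule.

Arguments multiples {A} a M.

Definition restr (A B : pzRingType) (f : {rmorphism A -> B}) (M : lmodType B)
  : Type := M.

Section Restriction.
Variables (A B : pzRingType) (f : {rmorphism A -> B}) (M : lmodType B).

Local Notation restr := (restr f M).

HB.instance Definition _ := GRing.Zmodule.on restr.

Definition restr_scale (a : A) (m : restr) : restr := f a *: (m : M).

Fact restr_scaleA a b m :
  restr_scale a (restr_scale b m) = restr_scale (a * b) m.
Proof. by rewrite /restr_scale scalerA rmorphM. Qed.
Fact restr_scale1 : left_id 1 restr_scale.
Proof. by move=> m; rewrite /restr_scale rmorph1 scale1r. Qed.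
Fact restr_scaleDr : right_distributive restr_scale +%R.
Proof. by move=> a m n; rewrite /restr_scale scalerDr. Qed.
Fact restr_scaleDl m : {morph restr_scale^~ m : a b / a + b}.
Proof. by move=> a b; rewrite /restr_scale rmorphD scalerDl. Qed.

HB.instance Definition _ := GRing.Zmodule_isLmodule.Build A restr
  restr_scaleA restr_scale1 restr_scaleDr restr_scaleDl.

End Restriction.

Section LocalizedModule.
Variables (A : comPzRingType) (S : mulrClosed A) (M : lmodType A).

Definition denom : Type := {s : A | s \in S}.
HB.instance Definition _ := Choice.on denom.

Definition denom1 : denom := exist _ 1 (rpred1 S).
Definition denomM (s s' : denom) : denom :=
  exist _ (val s * val s') (rpredM (valP s) (valP s')).

Definition loc_rel (p q : M * denom) : bool :=
  `[< exists2 u, u \in S & u *: (val q.2 *: p.1) = u *: (val p.2 *: q.1) >].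

Fact loc_rel_equiv : equiv_class_of loc_rel.
Proof.
split=> [p|p q|q p r].
- by apply/asboolP; exists 1; rewrite ?rpred1.
- by apply/asboolP/asboolP => -[u uS e]; exists u.
move=> /asboolP[u uS e] /asboolP[v vS e']; apply/asboolP.
exists (u * v * val q.2); first by rewrite !rpredM // (valP q.2).
have {}e := congr1 (fun m => (v * val r.2) *: m) e.
have {}e' := congr1 (fun m => (u * val p.2) *: m) e'.
rewrite !scalerA in e e' *.
rewrite (_ : u * v * _ * _ = v * val r.2 * u * val q.2); last by ring.
rewrite e (_ : v * val r.2 * u * val p.2 = u * val p.2 * v * val r.2);
  last by ring.
by rewrite e'; congr (_ *: _); ring.
Qed.

Canonical loc_rel_equiv_rel := EquivRelPack loc_rel_equiv.
Canonical loc_rel_encModRel := defaultEncModRel loc_rel.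

Definition locmod : Type := {eq_quot loc_rel}.
HB.instance Definition _ := Choice.on locmod.

Definition locfrac (m : M) (s : denom) : locmod := \pi_({eq_quot loc_rel}) (m, s).

Definition locnum (y : locmod) : M := (repr (y : {eq_quot loc_rel})).1.
Definition locden (y : locmod) : denom := (repr (y : {eq_quot loc_rel})).2.

Fact locfrac_numden y : locfrac (locnum y) (locden y) = y.
Proof. by rewrite /locfrac -surjective_pairing reprK. Qed.

Fact locfracP (y : locmod) : exists m s, y = locfrac m s.
Proof. by exists (locnum y), (locden y); rewrite locfrac_numden. Qed.

Fact locfrac_eq m s n s' : locfrac m s = locfrac n s' <->
  exists2 u, u \in S & u *: (val s' *: m) = u *: (val s *: n).
Proof.
rewrite /locfrac; split=> [/eqP|H]; last by apply/eqP; rewrite piE; apply/asboolP.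
by rewrite piE => /asboolP.
Qed.

Definition loc_add (y z : locmod) : locmod :=
  locfrac (val (locden z) *: locnum y + val (locden y) *: locnum z)
          (denomM (locden y) (locden z)).
Definition loc_opp (y : locmod) : locmod := locfrac (- locnum y) (locden y).
Definition loc_zero : locmod := locfrac 0 denom1.

Fact loc_addE m s n s' : loc_add (locfrac m s) (locfrac n s') =
  locfrac (val s' *: m + val s *: n) (denomM s s').
Proof.
rewrite /loc_add; set y := locfrac m s; set z := locfrac n s'.
have /locfrac_eq[u uS e] := locfrac_numden y.
have /locfrac_eq[v vS e'] := locfrac_numden z.
apply/locfrac_eq; exists (u * v); first exact: rpredM.
move: e e'; move: (locnum y) (locnum z) (locden y) (locden z) => a b c d e e'.
have {}e := congr1 (fun m => (v * val s' * val d) *: m) e.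
have {}e' := congr1 (fun m => (u * val s * val c) *: m) e'.
rewrite /= !scalerDr !scalerA in e e' *; congr (_ + _).
  by move: e; congr (_ *: _ = _ *: _); ring.
by move: e'; congr (_ *: _ = _ *: _); ring.
Qed.

Fact loc_oppE m s : loc_opp (locfrac m s) = locfrac (- m) s.
Proof.
rewrite /loc_opp; have /locfrac_eq[u uS e] := locfrac_numden (locfrac m s).
by apply/locfrac_eq; exists u => //; rewrite !scalerN e.
Qed.

Fact locfrac_congr m s n s' :
  m = n -> val s = val s' -> locfrac m s = locfrac n s'.
Proof. by move=> -> /val_inj ->. Qed.

Fact loc_addA : associative loc_add.
Proof.
move=> x y z; have [m [s ->]] := locfracP x; have [n [s' ->]] := locfracP y.
have [p [s'' ->]] := locfracP z; rewrite !loc_addE.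
apply: locfrac_congr => /=; last by rewrite mulrA.
by rewrite !scalerDr !scalerA addrA; congr (_ *: _ + _ *: _ + _ *: _); ring.
Qed.

Fact loc_addC : commutative loc_add.
Proof.
move=> x y; have [m [s ->]] := locfracP x; have [n [s' ->]] := locfracP y.
by rewrite !loc_addE; apply: locfrac_congr; rewrite /= (addrC, mulrC).
Qed.

Fact loc_add0 : left_id loc_zero loc_add.
Proof.
move=> x; have [m [s ->]] := locfracP x; rewrite /loc_zero loc_addE.
by apply: locfrac_congr; rewrite /= ?mul1r // scaler0 scale1r add0r.
Qed.

Fact loc_addN : left_inverse loc_zero loc_opp loc_add.
Proof.
move=> x; have [m [s ->]] := locfracP x; rewrite loc_oppE loc_addE.
apply/locfrac_eq; exists 1; first exact: rpred1.
by rewrite scalerN addNr !scaler0.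
Qed.

HB.instance Definition _ :=
  GRing.isZmodule.Build locmod loc_addA loc_addC loc_add0 loc_addN.

Fact locfracD m s n s' : locfrac m s + locfrac n s' =
  locfrac (val s' *: m + val s *: n) (denomM s s').
Proof. exact: loc_addE. Qed.

End LocalizedModule.

(* [S^-1 A], the product being the case [M = A] of the action of [S^-1 A] on
   [S^-1 M]. *)
Definition locring (A : comPzRingType) (S : mulrClosed A) : Type := locmod S A^o.
HB.instance Definition _ (A : comPzRingType) (S : mulrClosed A) :=
  GRing.Zmodule.on (locring S).

Section LocalizedAction.
Variables (A : comPzRingType) (S : mulrClosed A) (M : lmodType A).

Definition loc_scale (c : locring S) (y : locmod S M) : locmod S M :=
  locfrac ((locnum c : A) *: locnum y) (denomM (locden c) (locden y)).

Fact loc_scaleE (a : A) s m s' :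
  loc_scale (locfrac (a : A^o) s) (locfrac m s') = locfrac (a *: m) (denomM s s').
Proof.
rewrite /loc_scale.
set y := locfrac (a : A^o) s; set z := locfrac m s'.
have /locfrac_eq[u uS e] := locfrac_numden y.
have /locfrac_eq[v vS e'] := locfrac_numden z.
apply/locfrac_eq; exists (u * v); first exact: rpredM.
move: e e'; move: (locnum y : A) (locnum z) (locden y) (locden z) => b n c d e e'.
have {}e' := congr1 (fun m => (u * (val s * b)) *: m) e'.
rewrite /= !scalerA in e' *.
rewrite (_ : u * v * _ * b = u * (sval s * b) * v * sval s'); last by ring.
rewrite e'; congr (_ *: _).
transitivity (u * (sval s * b) * (v * sval d)); first by ring.
have {}e : u * (sval s * b) = u * (sval c * a) := e.
by rewrite e; ring.
Qed.

End LocalizedAction.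

Section LocalizedRing.
Variables (A : comPzRingType) (S : mulrClosed A).

Definition loc_one : locring S := locfrac (1 : A^o) (denom1 S).

Definition loc_mul (c d : locring S) : locring S := loc_scale c d.

Fact locringP (c : locring S) : exists (a : A) s, c = locfrac (a : A^o) s.
Proof. exact: (@locfracP A S A^o c). Qed.

Fact loc_mulE (a b : A) (s s' : denom S) :
  loc_mul (locfrac (a : A^o) s) (locfrac (b : A^o) s') =
  locfrac (a * b : A^o) (denomM s s').
Proof. exact: loc_scaleE. Qed.

Fact loc_mulA : associative loc_mul.
Proof.
move=> x y z; have [a [s ->]] := locringP x; have [b [s' ->]] := locringP y.
have [c [s'' ->]] := locringP z; rewrite !loc_mulE.
by apply: locfrac_congr; rewrite /= mulrA.
Qed.

Fact loc_mulC : commutative loc_mul.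
Proof.
move=> x y; have [a [s ->]] := locringP x; have [b [s' ->]] := locringP y.
by rewrite !loc_mulE; apply: locfrac_congr; rewrite /= mulrC.
Qed.

Fact loc_mul1 : left_id loc_one loc_mul.
Proof.
move=> x; have [a [s ->]] := locringP x.
by rewrite /loc_one loc_mulE; apply: locfrac_congr; rewrite /= mul1r.
Qed.

Fact loc_ringD (a b : A) (s s' : denom S) :
  (locfrac (a : A^o) s : locring S) + locfrac (b : A^o) s' =
  locfrac (val s' * a + val s * b : A^o) (denomM s s').
Proof. exact: loc_addE. Qed.

Fact loc_mulDl : left_distributive loc_mul +%R.
Proof.
move=> x y z; have [a [s ->]] := locringP x; have [b [s' ->]] := locringP y.
have [c [s'' ->]] := locringP z.
have e := congr1 (loc_mul^~ (locfrac (c : A^o) s'')) (loc_ringD a b s s').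
apply: (etrans e); rewrite !loc_mulE loc_ringD.
by apply/locfrac_eq; exists 1; rewrite ?rpred1 //= /GRing.scale /=; ring.
Qed.

HB.instance Definition _ := GRing.Zmodule_isComPzRing.Build (locring S)
  loc_mulA loc_mulC loc_mul1 loc_mulDl.

End LocalizedRing.

Section LocalizedModuleLmodule.
Variables (A : comPzRingType) (S : mulrClosed A) (M : lmodType A).

Fact loc_scaleA (c d : locring S) (y : locmod S M) :
  loc_scale c (loc_scale d y) = loc_scale (c * d) y.
Proof.
have [a [s ->]] := locringP c; have [b [s' ->]] := locringP d.
have [m [s'' ->]] := locfracP y.
rewrite [_ * _]loc_mulE !loc_scaleE.
by apply: locfrac_congr; rewrite /= (scalerA, mulrA).
Qed.

Fact loc_scale1 : left_id 1 (@loc_scale A S M).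
Proof.
move=> y; have [m [s ->]] := locfracP y.
by rewrite [1]/(loc_one S) loc_scaleE; apply: locfrac_congr; rewrite /= (scale1r, mul1r).
Qed.

Fact loc_scaleDr : right_distributive (@loc_scale A S M) +%R.
Proof.
move=> c y z; have [a [s ->]] := locringP c.
have [m [s' ->]] := locfracP y; have [n [s'' ->]] := locfracP z.
rewrite locfracD !loc_scaleE locfracD.
apply/locfrac_eq; exists 1; rewrite ?rpred1 //= !scalerDr !scalerA.
by congr (_ *: _ + _ *: _); ring.
Qed.

Fact loc_scaleDl (y : locmod S M) : {morph (@loc_scale A S M)^~ y : c d / c + d}.
Proof.
move=> c d; have [a [s ->]] := locringP c; have [b [s' ->]] := locringP d.
have [m [s'' ->]] := locfracP y.
have e := congr1 ((@loc_scale A S M)^~ (locfrac m s'')) (loc_ringD a b s s').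
apply: (etrans e); rewrite !loc_scaleE locfracD.
apply/locfrac_eq; exists 1; rewrite ?rpred1 //= !scalerDl !scalerDr !scalerA.
by congr (_ *: _ + _ *: _); ring.
Qed.

HB.instance Definition _ := GRing.Zmodule_isLmodule.Build (locring S) (locmod S M)
  loc_scaleA loc_scale1 loc_scaleDr loc_scaleDl.

End LocalizedModuleLmodule.

Section LocalizationMaps.
Variables (A : comPzRingType) (S : mulrClosed A).

Definition loc_in (a : A) : locring S := locfrac (a : A^o) (denom1 S).

Fact loc_in_zmod_morphism : zmod_morphism loc_in.
Proof.
apply: additive_zmod_morphism => a b; rewrite [RHS]loc_ringD.
by apply: locfrac_congr; rewrite /= ?mul1r ?mulr1.
Qed.

Fact loc_in_monoid_morphism : monoid_morphism loc_in.
Proof.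
split=> // a b; rewrite [RHS]loc_mulE.
by apply: locfrac_congr; rewrite //= mulr1.
Qed.

HB.instance Definition _ :=
  GRing.isZmodMorphism.Build A (locring S) loc_in loc_in_zmod_morphism.
HB.instance Definition _ :=
  GRing.isMonoidMorphism.Build A (locring S) loc_in loc_in_monoid_morphism.

Variables (B : comPzRingType) (S' : mulrClosed B) (f : {rmorphism A -> B}).
Hypothesis fS : forall s, s \in S -> f s \in S'.

Definition denom_map (s : denom S) : denom S' :=
  exist (fun b => b \in S') (f (val s)) (fS (valP s)).

Definition loc_map (c : locring S) : locring S' :=
  locfrac (f (locnum c) : B^o) (denom_map (locden c)).

Fact loc_mapE (a : A) (s : denom S) : loc_map (locfrac (a : A^o) s) =
  locfrac (f a : B^o) (denom_map s).
Proof.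
rewrite /loc_map; have /locfrac_eq[u uS e] := locfrac_numden (locfrac (a : A^o) s).
apply/locfrac_eq; exists (f u); first exact: fS.
by have := congr1 f e; rewrite /GRing.scale /= !rmorphM.
Qed.

Fact loc_map_zmod_morphism : zmod_morphism loc_map.
Proof.
apply: additive_zmod_morphism => x y; have [a [s ->]] := locringP x; have [b [s' ->]] := locringP y.
rewrite (loc_ringD a b s s') !loc_mapE loc_ringD.
by apply: locfrac_congr; rewrite /= ?rmorphD !rmorphM.
Qed.

Fact loc_map_monoid_morphism : monoid_morphism loc_map.
Proof.
split=> [|x y].
  by rewrite [1 in LHS]/(loc_one S) loc_mapE; apply: locfrac_congr; rewrite /= rmorph1.
have [a [s ->]] := locringP x; have [b [s' ->]] := locringP y.
rewrite [_ * _ in LHS]loc_mulE !loc_mapE [RHS]loc_mulE.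
by apply: locfrac_congr; rewrite /= rmorphM.
Qed.

HB.instance Definition _ :=
  GRing.isZmodMorphism.Build (locring S) (locring S') loc_map loc_map_zmod_morphism.
HB.instance Definition _ :=
  GRing.isMonoidMorphism.Build (locring S) (locring S') loc_map
    loc_map_monoid_morphism.

End LocalizationMaps.

(* The multiplicative set of powers of [a]: localizing there inverts [a]. *)
Section Powers.
Variables (A : comPzRingType) (a : A).

Definition powers : {pred A} := [pred b | `[< exists n, b = a ^+ n >]].

Fact powers_closed : mulr_closed powers.
Proof.
split=> [|b c /asboolP[m ->] /asboolP[n ->]]; apply/asboolP.
  by exists 0%N; rewrite expr0.
by exists (m + n)%N; rewrite exprD.
Qed.

HB.instance Definition _ := GRing.isMulClosed.Build A powers powers_closed.

End Powers.

Section Tensor.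
Variables (k : comPzRingType) (M N : lmodType k).

(* [M (x)_k N] is the commutative monoid generated by the pairs [(m, n)] subject
   to the bilinearity relations, which make it a group; a sequence of pairs
   stands for the sum of the corresponding pure tensors. *)
Inductive tensor_eq : seq (M * N) -> seq (M * N) -> Prop :=
| Tensor_refl s : tensor_eq s s
| Tensor_sym s t : tensor_eq s t -> tensor_eq t s
| Tensor_trans s t u : tensor_eq s t -> tensor_eq t u -> tensor_eq s u
| Tensor_cat s s' t t' :
    tensor_eq s s' -> tensor_eq t t' -> tensor_eq (s ++ t) (s' ++ t')
| Tensor_comm s t : tensor_eq (s ++ t) (t ++ s)
| Tensor_zero n : tensor_eq [:: (0, n)] [::]
| Tensor_addl m m' n : tensor_eq [:: (m + m', n)] [:: (m, n); (m', n)]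
| Tensor_addr m n n' : tensor_eq [:: (m, n + n')] [:: (m, n); (m, n')]
| Tensor_scale a m n : tensor_eq [:: (a *: m, n)] [:: (m, a *: n)].

Definition tensor_rel (s t : seq (M * N)) : bool := `[< tensor_eq s t >].

Fact tensor_rel_equiv : equiv_class_of tensor_rel.
Proof.
split=> [s|s t|t s u].
- by apply/asboolP; apply: Tensor_refl.
- by apply/asboolP/asboolP; apply: Tensor_sym.
by move=> /asboolP H /asboolP H'; apply/asboolP; apply: Tensor_trans H H'.
Qed.

Canonical tensor_rel_equiv_rel := EquivRelPack tensor_rel_equiv.
Canonical tensor_rel_encModRel := defaultEncModRel tensor_rel.

Definition tensor : Type := {eq_quot tensor_rel}.
HB.instance Definition _ := Choice.on tensor.

Definition tensor_of (s : seq (M * N)) : tensor := \pi_({eq_quot tensor_rel}) s.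
Definition tensor_repr (x : tensor) : seq (M * N) :=
  repr (x : {eq_quot tensor_rel}).

Definition tens (m : M) (n : N) : tensor := tensor_of [:: (m, n)].

Fact tensor_of_eq s t : tensor_of s = tensor_of t <-> tensor_eq s t.
Proof.
rewrite /tensor_of; split=> [/eqP|H]; last by apply/eqP; rewrite piE; apply/asboolP.
by rewrite piE => /asboolP.
Qed.

Fact tensor_reprK x : tensor_of (tensor_repr x) = x.
Proof. exact: reprK. Qed.

Fact tensor_ofP x : exists s, x = tensor_of s.
Proof. by exists (tensor_repr x); rewrite tensor_reprK. Qed.

Definition tensor_add x y := tensor_of (tensor_repr x ++ tensor_repr y).
Definition tensor_opp x := tensor_of [seq (- p.1, p.2) | p <- tensor_repr x].

Fact tensor_addE s t : tensor_add (tensor_of s) (tensor_of t) = tensor_of (s ++ t).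
Proof. by apply/tensor_of_eq; apply: Tensor_cat; apply/tensor_of_eq/tensor_reprK. Qed.

Fact tensor_addA : associative tensor_add.
Proof.
move=> x y z; have [s ->] := tensor_ofP x; have [t ->] := tensor_ofP y.
have [u ->] := tensor_ofP z.
by rewrite (tensor_addE t u) (tensor_addE s t) (tensor_addE s (t ++ u)) (tensor_addE (s ++ t) u) catA.
Qed.

Fact tensor_addC : commutative tensor_add.
Proof.
move=> x y; have [s ->] := tensor_ofP x; have [t ->] := tensor_ofP y.
by rewrite (tensor_addE s t) (tensor_addE t s); apply/tensor_of_eq/Tensor_comm.
Qed.

Fact tensor_add0 : left_id (tensor_of [::]) tensor_add.
Proof. by move=> x; have [s ->] := tensor_ofP x; rewrite (tensor_addE [::] s). Qed.

Fact tensor_addN : left_inverse (tensor_of [::]) tensor_opp tensor_add.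
Proof.
move=> x; rewrite -{2}[x]tensor_reprK tensor_addE; apply/tensor_of_eq.
elim: (tensor_repr x) => [|[m n] s IH] /=; first exact: Tensor_refl.
apply: Tensor_trans (Tensor_cat (s := [:: (- m, n); (m, n)]) (s' := [::]) _ IH).
  set s' := map _ s; apply: (Tensor_cat (s := [:: (- m, n)]) (s' := [:: (- m, n)])
    (t := s' ++ [:: (m, n)] ++ s) (t' := [:: (m, n)] ++ s' ++ s)).
    exact: Tensor_refl.
  by rewrite !catA; apply: Tensor_cat (Tensor_comm _ _) (Tensor_refl _).
apply: Tensor_trans (Tensor_sym (Tensor_addl _ _ _)) _.
by rewrite addNr; apply: Tensor_zero.
Qed.

HB.instance Definition _ := GRing.isZmodule.Build tensor
  tensor_addA tensor_addC tensor_add0 tensor_addN.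

Fact tensor_ofD s t : tensor_of (s ++ t) = tensor_of s + tensor_of t.
Proof. by rewrite [RHS]tensor_addE. Qed.

Fact tensDl m m' n : tens (m + m') n = tens m n + tens m' n.
Proof.
by rewrite /tens -tensor_ofD; apply: (tensor_of_eq _ _).2; apply: Tensor_addl.
Qed.

Fact tensDr m n n' : tens m (n + n') = tens m n + tens m n'.
Proof.
by rewrite /tens -tensor_ofD; apply: (tensor_of_eq _ _).2; apply: Tensor_addr.
Qed.

Fact tensZ a m n : tens (a *: m) n = tens m (a *: n).
Proof. by apply: (tensor_of_eq _ _).2; apply: Tensor_scale. Qed.

Fact tensor_ind (P : tensor -> Prop) :
  (forall m n, P (tens m n)) -> (forall x y, P x -> P y -> P (x + y)) ->
  forall x, P x.
Proof.
move=> Ptens PD x; have [s ->] := tensor_ofP x.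
elim: s => [|[m n] s IH]; last by rewrite -cat1s tensor_ofD; apply: PD (Ptens m n) IH.
have -> : tensor_of [::] = tens 0 0.
  by apply: (tensor_of_eq _ _).2; apply: Tensor_sym; apply: Tensor_zero.
exact: Ptens.
Qed.

Definition balanced (W : zmodType) (f : M -> N -> W) : Prop :=
  [/\ forall m m' n, f (m + m') n = f m n + f m' n,
      forall m n n', f m (n + n') = f m n + f m n' &
      forall a m n, f (a *: m) n = f m (a *: n)].

(* The additive map [tens m n |-> f m n], for balanced [f]. *)
Definition tensor_lift (W : zmodType) (f : M -> N -> W) (x : tensor) : W :=
  \sum_(p <- tensor_repr x) f p.1 p.2.

Section Lift.
Variables (W : zmodType) (f : M -> N -> W).
Hypothesis f_bal : balanced f.

Fact tensor_lift_of s : tensor_lift f (tensor_of s) = \sum_(p <- s) f p.1 p.2.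
Proof.
have [fDl fDr fZ] := f_bal.
have /tensor_of_eq : tensor_of (tensor_repr (tensor_of s)) = tensor_of s.
  exact: tensor_reprK.
rewrite /tensor_lift; move: (tensor_repr _) => r; elim=> {r s} //.
- by move=> s t u _ -> _ ->.
- by move=> s s' t t' _ e _ e'; rewrite !big_cat /= e e'.
- by move=> s t; rewrite !big_cat /= addrC.
- move=> n; rewrite big_seq1 big_nil /=.
  by apply: (addrI (f 0 n)); rewrite -fDl !addr0.
- by move=> m m' n; rewrite !big_cons !big_nil /= !addr0 fDl.
- by move=> m n n'; rewrite !big_cons !big_nil /= !addr0 fDr.
- by move=> a m n; rewrite !big_seq1 /= fZ.
Qed.

Fact tensor_lift_tens m n : tensor_lift f (tens m n) = f m n.
Proof. by rewrite tensor_lift_of big_seq1. Qed.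

Fact tensor_liftD x y : tensor_lift f (x + y) = tensor_lift f x + tensor_lift f y.
Proof.
have [s ->] := tensor_ofP x; have [t ->] := tensor_ofP y.
by rewrite -tensor_ofD !tensor_lift_of big_cat.
Qed.

End Lift.

End Tensor.

(* [A (x)_k B] for two [k]-algebras, that is, rings with ring morphisms from [k];
   its product is the case [M = A], [N = B] of its action on [M (x)_k N]. *)
Definition tensor_ring (k A B : comPzRingType)
    (iA : {rmorphism k -> A}) (iB : {rmorphism k -> B}) : Type :=
  tensor (restr iA A^o) (restr iB B^o).

Definition tensor_mod (k A B : comPzRingType)
    (iA : {rmorphism k -> A}) (iB : {rmorphism k -> B})
    (M : lmodType A) (N : lmodType B) : Type :=
  tensor (restr iA M) (restr iB N).

(* The ring morphism [tens_ring a b |-> f a * g b]; that it is one depends on the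
   hypothesis that [f] and [g] agree on [k]. *)
Definition tensor_copair (k A B : comPzRingType)
    (iA : {rmorphism k -> A}) (iB : {rmorphism k -> B})
    (C : comPzRingType) (f : {rmorphism A -> C}) (g : {rmorphism B -> C})
    (fg : forall c, f (iA c) = g (iB c)) (x : tensor_ring iA iB) : C :=
  tensor_lift (fun (a : restr iA A^o) (b : restr iB B^o) => f a * g b) x.

Section TensorAlgebra.
Variables (k A B : comPzRingType).
Variables (iA : {rmorphism k -> A}) (iB : {rmorphism k -> B}).

Local Notation AB := (tensor_ring iA iB).

HB.instance Definition _ := GRing.Zmodule.on AB.

Definition tens_ring (a : A) (b : B) : AB :=
  tens (a : restr iA A^o) (b : restr iB B^o).

Fact tens_ringDl a a' b : tens_ring (a + a') b = tens_ring a b + tens_ring a' b.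
Proof. exact: tensDl. Qed.
Fact tens_ringDr a b b' : tens_ring a (b + b') = tens_ring a b + tens_ring a b'.
Proof. exact: tensDr. Qed.
Fact tens_ringZ c a b : tens_ring (iA c * a) b = tens_ring a (iB c * b).
Proof. exact: (@tensZ k (restr iA A^o) (restr iB B^o)). Qed.
Fact tensor_ring_ind (P : AB -> Prop) :
  (forall a b, P (tens_ring a b)) -> (forall x y, P x -> P y -> P (x + y)) ->
  forall x, P x.
Proof. exact: (@tensor_ind k (restr iA A^o) (restr iB B^o)). Qed.

Section Action.
Variables (M : lmodType A) (N : lmodType B).

Local Notation MN := (tensor_mod iA iB M N).

HB.instance Definition _ := GRing.Zmodule.on MN.

Definition tens_mod (m : M) (n : N) : MN :=
  tens (m : restr iA M) (n : restr iB N).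

Fact tens_modDl m m' n : tens_mod (m + m') n = tens_mod m n + tens_mod m' n.
Proof. exact: tensDl. Qed.
Fact tens_modDr m n n' : tens_mod m (n + n') = tens_mod m n + tens_mod m n'.
Proof. exact: tensDr. Qed.
Fact tens_modZ c m n : tens_mod (iA c *: m) n = tens_mod m (iB c *: n).
Proof. exact: (@tensZ k (restr iA M) (restr iB N)). Qed.
Fact tensor_mod_ind (P : MN -> Prop) :
  (forall m n, P (tens_mod m n)) -> (forall x y, P x -> P y -> P (x + y)) ->
  forall x, P x.
Proof. exact: (@tensor_ind k (restr iA M) (restr iB N)). Qed.

Definition tensor_act1 (a : A) (b : B) (y : MN) : MN :=
  tensor_lift (fun (m : restr iA M) (n : restr iB N) =>
    tens_mod (a *: (m : M)) (b *: (n : N))) y.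

Definition tensor_act (c : AB) (y : MN) : MN :=
  tensor_lift (fun (a : restr iA A^o) (b : restr iB B^o) => tensor_act1 a b y) c.

Fact tensor_act1_balanced (a : A) (b : B) :
  balanced (fun (m : restr iA M) (n : restr iB N) =>
    tens_mod (a *: (m : M)) (b *: (n : N))).
Proof.
split=> [m m' n|m n n'|c m n].
- by rewrite scalerDr tens_modDl.
- by rewrite scalerDr tens_modDr.
rewrite -![c *: _]/(_ c *: (_ : _)).
rewrite (_ : a *: (iA c *: (m : M)) = iA c *: (a *: (m : M))).
  by rewrite tens_modZ !scalerA mulrC.
by rewrite !scalerA mulrC.
Qed.

Fact tensor_act1_tens a b m n :
  tensor_act1 a b (tens_mod m n) = tens_mod (a *: m) (b *: n).
Proof. exact: (tensor_lift_tens (tensor_act1_balanced a b)). Qed.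

Fact tensor_act1D a b y z :
  tensor_act1 a b (y + z) = tensor_act1 a b y + tensor_act1 a b z.
Proof. exact: (tensor_liftD (tensor_act1_balanced a b)). Qed.

Fact tensor_act_balanced (y : MN) :
  balanced (fun (a : restr iA A^o) (b : restr iB B^o) => tensor_act1 a b y).
Proof.
split=> [a a' b|a b b'|c a b]; elim/tensor_mod_ind: y => [m n|y z IHy IHz].
- by rewrite !tensor_act1_tens -tens_modDl -scalerDl.
- by rewrite !tensor_act1D IHy IHz addrACA.
- by rewrite !tensor_act1_tens -tens_modDr -scalerDl.
- by rewrite !tensor_act1D IHy IHz addrACA.
- rewrite !tensor_act1_tens -[in LHS](scalerA (iA c : A)) tens_modZ.
  by rewrite scalerA.
by rewrite !tensor_act1D IHy IHz.
Qed.

Fact tensor_act_tens a b m n :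
  tensor_act (tens_ring a b) (tens_mod m n) = tens_mod (a *: m) (b *: n).
Proof.
rewrite -tensor_act1_tens.
exact: (tensor_lift_tens (tensor_act_balanced (tens_mod m n))).
Qed.

Fact tensor_actDl c d y : tensor_act (c + d) y = tensor_act c y + tensor_act d y.
Proof. exact: (tensor_liftD (tensor_act_balanced y)). Qed.

Fact tensor_actDr c y z : tensor_act c (y + z) = tensor_act c y + tensor_act c z.
Proof.
by rewrite /tensor_act /tensor_lift -big_split; apply: eq_bigr => p _; apply: tensor_act1D.
Qed.

End Action.

Definition tensor_one : AB := tens_ring 1 1.
Definition tensor_mul (c d : AB) : AB := @tensor_act A^o B^o c d.

Fact tensor_mul_tens a b a' b' :
  tensor_mul (tens_ring a b) (tens_ring a' b') = tens_ring (a * a') (b * b').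
Proof. exact: (@tensor_act_tens A^o B^o). Qed.
Fact tensor_mulDl : left_distributive tensor_mul +%R.
Proof. move=> x y z; exact: (@tensor_actDl A^o B^o). Qed.
Fact tensor_mulDr : right_distributive tensor_mul +%R.
Proof. move=> x y z; exact: (@tensor_actDr A^o B^o). Qed.

Fact tensor_mulC : commutative tensor_mul.
Proof.
move=> x y; elim/tensor_ring_ind: x => [a b|x x' IH IH']; last first.
  by rewrite tensor_mulDl tensor_mulDr IH IH'.
elim/tensor_ring_ind: y => [a' b'|y y' IH IH']; last first.
  by rewrite tensor_mulDl tensor_mulDr IH IH'.
by rewrite !tensor_mul_tens mulrC [b * _]mulrC.
Qed.

Fact tensor_mulA : associative tensor_mul.
Proof.
move=> x y z; elim/tensor_ring_ind: x => [a b|x x' IH IH']; last first.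
  by rewrite !tensor_mulDl IH IH'.
elim/tensor_ring_ind: y => [a' b'|y y' IH IH']; last first.
  by rewrite tensor_mulDr !tensor_mulDl tensor_mulDr IH IH'.
elim/tensor_ring_ind: z => [a'' b''|z z' IH IH']; last first.
  by rewrite !tensor_mulDr IH IH'.
by rewrite !tensor_mul_tens !mulrA.
Qed.

Fact tensor_mul1 : left_id tensor_one tensor_mul.
Proof.
move=> x; elim/tensor_ring_ind: x => [a b|x x' IH IH']; last first.
  by rewrite tensor_mulDr IH IH'.
by rewrite tensor_mul_tens !mul1r.
Qed.

HB.instance Definition _ := GRing.Zmodule_isComPzRing.Build AB
  tensor_mulA tensor_mulC tensor_mul1 tensor_mulDl.

Fact tens_ringM a b a' b' :
  tens_ring a b * tens_ring a' b' = tens_ring (a * a') (b * b').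
Proof. exact: tensor_mul_tens. Qed.

Section ActionLmodule.
Variables (M : lmodType A) (N : lmodType B).

Local Notation act := (@tensor_act M N).

Fact tensor_actA c d y : act c (act d y) = act (c * d) y.
Proof.
elim/tensor_mod_ind: y => [m n|y y' IH IH']; last by rewrite !tensor_actDr IH IH'.
elim/tensor_ring_ind: c => [a b|x x' IH IH']; last first.
  by rewrite tensor_actDl IH IH' mulrDl tensor_actDl.
elim/tensor_ring_ind: d => [a' b'|y y' IH IH']; last first.
  by rewrite tensor_actDl tensor_actDr IH IH' mulrDr tensor_actDl.
by rewrite tens_ringM !tensor_act_tens !scalerA.
Qed.

Fact tensor_act_1 : left_id 1 act.
Proof.
move=> y; elim/tensor_mod_ind: y => [m n|y y' IH IH'].
  by rewrite tensor_act_tens !scale1r.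
by rewrite tensor_actDr IH IH'.
Qed.

Fact tensor_act_Dr : right_distributive act +%R.
Proof. exact: tensor_actDr. Qed.
Fact tensor_act_Dl y : {morph act^~ y : c d / c + d}.
Proof. by move=> c d; apply: tensor_actDl. Qed.

HB.instance Definition _ := GRing.Zmodule_isLmodule.Build AB (tensor_mod iA iB M N)
  tensor_actA tensor_act_1 tensor_act_Dr tensor_act_Dl.

End ActionLmodule.

Definition tensor_inl (a : A) : AB := tens_ring a 1.
Definition tensor_inr (b : B) : AB := tens_ring 1 b.

Fact tensor_inl_zmod_morphism : zmod_morphism tensor_inl.
Proof.
by apply: additive_zmod_morphism => a b; apply: tens_ringDl.
Qed.
Fact tensor_inl_monoid_morphism : monoid_morphism tensor_inl.
Proof. by split=> // a b; rewrite tens_ringM mulr1. Qed.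

HB.instance Definition _ :=
  GRing.isZmodMorphism.Build A AB tensor_inl tensor_inl_zmod_morphism.
HB.instance Definition _ :=
  GRing.isMonoidMorphism.Build A AB tensor_inl tensor_inl_monoid_morphism.

Fact tensor_inr_zmod_morphism : zmod_morphism tensor_inr.
Proof.
by apply: additive_zmod_morphism => a b; apply: tens_ringDr.
Qed.
Fact tensor_inr_monoid_morphism : monoid_morphism tensor_inr.
Proof. by split=> // a b; rewrite tens_ringM mulr1. Qed.

HB.instance Definition _ :=
  GRing.isZmodMorphism.Build B AB tensor_inr tensor_inr_zmod_morphism.
HB.instance Definition _ :=
  GRing.isMonoidMorphism.Build B AB tensor_inr tensor_inr_monoid_morphism.

Fact tensor_inlr c : tensor_inl (iA c) = tensor_inr (iB c).
Proof. by rewrite /tensor_inl -[iA c]mulr1 tens_ringZ mulr1. Qed.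

Section Copairing.
Variables (C : comPzRingType) (f : {rmorphism A -> C}) (g : {rmorphism B -> C}).
Hypothesis fg : forall c, f (iA c) = g (iB c).

Local Notation tensor_copair := (@tensor_copair k A B iA iB C f g fg).

Fact tensor_copair_balanced :
  balanced (fun (a : restr iA A^o) (b : restr iB B^o) => f a * g b).
Proof.
split=> [a a' b|a b b'|c a b]; rewrite ?rmorphD ?mulrDl ?mulrDr //.
rewrite -[c *: a]/(iA c * (a : A)) -[c *: b]/(iB c * (b : B)).
by rewrite !rmorphM fg mulrCA mulrA.
Qed.

Fact tensor_copair_tens a b : tensor_copair (tens_ring a b) = f a * g b.
Proof. exact: (tensor_lift_tens tensor_copair_balanced). Qed.

Fact tensor_copairD x y : tensor_copair (x + y) = tensor_copair x + tensor_copair y.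
Proof. exact: (tensor_liftD tensor_copair_balanced). Qed.

Fact tensor_copair_zmod_morphism : zmod_morphism tensor_copair.
Proof.
exact: additive_zmod_morphism tensor_copairD.
Qed.

Fact tensor_copair_monoid_morphism : monoid_morphism tensor_copair.
Proof.
split=> [|x y]; first by rewrite tensor_copair_tens !rmorph1 mulr1.
elim/tensor_ring_ind: x => [a b|x x' IH IH']; last first.
  by rewrite mulrDl !tensor_copairD IH IH' mulrDl.
elim/tensor_ring_ind: y => [a' b'|y y' IH IH']; last first.
  by rewrite mulrDr !tensor_copairD IH IH' mulrDr.
by rewrite tens_ringM !tensor_copair_tens !rmorphM mulrACA.
Qed.

HB.instance Definition _ :=
  GRing.isZmodMorphism.Build AB C tensor_copair tensor_copair_zmod_morphism.
HB.instance Definition _ :=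
  GRing.isMonoidMorphism.Build AB C tensor_copair tensor_copair_monoid_morphism.

End Copairing.

End TensorAlgebra.

Definition tensor_map_r (k : comPzRingType) (M E F : lmodType k)
    (f : {linear E -> F}) : tensor M E -> tensor M F :=
  tensor_lift (fun m e => tens m (f e)).

Definition flat (A : comPzRingType) (Q : lmodType A) : Prop :=
  forall (E F : lmodType A) (f : {linear E -> F}),
    injective f -> injective (@tensor_map_r A Q E F f).

(* [V] is a discrete valuation ring with maximal ideal [tV]: a principal ideal
   domain which is not a field and whose nonunits are the multiples of [t]. *)
Definition dvr_uniformizer (V : idomainType) (t : V) : Prop :=
  [/\ forall I : submodClosed V^o, exists a : V,
        forall v : V, v \in I <-> exists w, v = a * w,
      t != 0 &
      forall v : V, (v \isn't a GRing.unit) <-> exists w, v = t * w].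

(* The composite [k -> V -> V / tV] is an isomorphism. *)
Definition residue_field_base (k : comPzRingType) (V : comPzRingType)
    (iV : {rmorphism k -> V}) (t : V) : Prop :=
  bijective (fun c : k => quotmod_pi (multiples t V^o) (iV c : V^o)).

Section InvertUniformizer.
Variables (k R V : comPzRingType).
Variables (iR : {rmorphism k -> R}) (iV : {rmorphism k -> V}) (t : V).

Local Notation RV := (tensor_ring iR iV).
Local Notation V_t := (locring (powers t)).

Definition invert_alg : {rmorphism k -> V_t} := loc_in (powers t) \o iV.

Definition tensor_uniformizer : RV := tensor_inr iR iV t.

Local Notation RV_t := (locring (powers tensor_uniformizer)).

Fact tensor_inr_powers v :
  v \in powers t -> tensor_inr iR iV v \in powers tensor_uniformizer.
Proof. by move=> /asboolP[n ->]; apply/asboolP; exists n; rewrite rmorphXn. Qed.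

Definition invert_inl : {rmorphism R -> RV_t} :=
  loc_in (powers tensor_uniformizer) \o tensor_inl iR iV.

Definition invert_inr : {rmorphism V_t -> RV_t} := loc_map tensor_inr_powers.

Fact invert_compat c : invert_inl (iR c) = invert_inr (invert_alg c).
Proof.
rewrite /= loc_mapE; apply: locfrac_congr => /=; first exact: tensor_inlr.
by rewrite rmorph1.
Qed.

(* The canonical map [R (x)_k V_t -> (R (x)_k V)_t]. *)
Definition invert_tensor : {rmorphism tensor_ring iR invert_alg -> RV_t} :=
  tensor_copair invert_compat.

(* [Q_t] as an [R (x)_k V_t]-module. *)
Definition invert_mod (Q : lmodType RV) : lmodType (tensor_ring iR invert_alg) :=
  restr invert_tensor (locmod (powers tensor_uniformizer) Q).

(* [M (x)_k V_t] as an [R (x)_k V_t]-module. *)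
Definition extend_mod (M : lmodType R) : lmodType (tensor_ring iR invert_alg) :=
  tensor_mod iR invert_alg M V_t^o.

End InvertUniformizer.

(* The [k]-algebra structure of [R] is given by [iR : k -> R]; the module
   [Q / tQ] is taken over [R (x)_k V] and then restricted to [R]. *)
Definition degenerates (k : fieldType) (R : comPzRingType)
    (iR : {rmorphism k -> R}) (M N : lmodType R) : Prop :=
  exists (V : idomainType) (iV : {rmorphism k -> V}) (t : V)
         (Q : lmodType (tensor_ring iR iV)),
  [/\ dvr_uniformizer t /\ residue_field_base iV t,
      finitely_generated Q,
      flat (restr (tensor_inr iR iV) Q),
      isomorphic (restr (tensor_inl iR iV)
                    (quotmod (multiples (tensor_uniformizer iR iV t) Q))) N &
      isomorphic (@invert_mod k R V iR iV t Q) (@extend_mod k R V iR iV t M)].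

Definition noetherian (A : comPzRingType) : Prop :=
  forall I : submodClosed A^o, finitely_generated (submod I).

(* [prime_idealr] requires a nontrivial ring. *)
Record primeIdeal (A : comPzRingType) := PrimeIdeal {
  prime_ideal :> submodClosed A^o;
  prime_proper : (1 : A^o) \notin prime_ideal;
  prime_mul : forall a b : A, (a * b : A^o) \in prime_ideal ->
    (a : A^o) \in prime_ideal \/ (b : A^o) \in prime_ideal }.

Section PrimeComplement.
Variables (A : comPzRingType) (p : primeIdeal A).

Definition prime_compl : {pred A} := [pred a | (a : A^o) \notin p].

Fact prime_compl_closed : mulr_closed prime_compl.
Proof.
split=> [|a b]; first exact: prime_proper.
rewrite !inE => ap bp; apply/negP => /prime_mul[H|H].
  by rewrite H in ap.
by rewrite H in bp.
Qed.

HB.instance Definition _ := GRing.isMulClosed.Build A prime_compl prime_compl_closed.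

End PrimeComplement.

(* [n <= dim A]: there is a chain [P 0 < P 1 < ... < P n] of prime ideals (the
   values of [P] beyond [n] are irrelevant). *)
Definition le_krull_dim (n : nat) (A : comPzRingType) : Prop :=
  exists P : nat -> primeIdeal A, forall i, (i < n)%N ->
    {subset P i <= P i.+1} /\ ~ {subset P i.+1 <= P i}.

(* [m] belongs to [(s_0, ..., s_(i-1)) M]. *)
Definition in_ideal_mul (A : comPzRingType) (M : lmodType A) (s : seq A)
    (i : nat) (m : M) : Prop :=
  exists f : nat -> M, m = \sum_(j < i) s`_j *: f j.

Definition regular_sequence (A : comPzRingType) (M : lmodType A) (s : seq A)
    : Prop :=
  (forall i (m : M), (i < size s)%N ->
     in_ideal_mul s i (s`_i *: m) -> in_ideal_mul s i m) /\
  (exists m : M, ~ in_ideal_mul s (size s) m).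

(* [n <= depth M] over a local ring [A], whose maximal ideal is the set of its
   nonunits; the zero module has infinite depth. *)
Definition le_depth (n : nat) (A : comPzRingType) (M : lmodType A) : Prop :=
  (forall m : M, m = 0) \/
  exists s : seq A, [/\ size s = n,
    forall a, a \in s -> ~ exists b, a * b = 1 &
    regular_sequence M s].

Definition cohen_macaulay (A : comPzRingType) (M : lmodType A) : Prop :=
  finitely_generated M /\
  forall (p : primeIdeal A) n,
    le_krull_dim n (locring (prime_compl p)) ->
    le_depth n (locmod (prime_compl p) M).

Section Setup.
Variables (R : comPzRingType) (L : lmodType R) (x : R).

Definition regular_element : Prop := forall l : L, x *: l = 0 -> l = 0.

Variables alpha beta : {linear L -> L}.

Definition Zmod : {pred L} :=
  [pred z | `[< exists s t, z = alpha s + x *: t >]].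

Fact Zmod_closed : submod_closed Zmod.
Proof.
split=> [|a u v]; first by apply/asboolP; exists 0, 0; rewrite linear0 scaler0 addr0.
move=> /asboolP[s [t ->]] /asboolP[s' [t' ->]]; apply/asboolP.
exists (a *: s + s'), (a *: t + t').
by rewrite linearP !scalerDr addrACA !scalerA [x * a]mulrC.
Qed.

HB.instance Definition _ := GRing.isSubmodClosed.Build R L Zmod
  (GRing.submod_closed_semi Zmod_closed).

Variable M : submodClosed L.

Definition Nmod : {pred L} :=
  [pred n | `[< exists m z, [/\ m \in M, z \in Zmod & n = beta m + x *: z] >]].

Fact Nmod_closed : submod_closed Nmod.
Proof.
split=> [|a u v].
  by apply/asboolP; exists 0, 0; rewrite !rpred0 linear0 scaler0 addr0.
move=> /asboolP[m [z [mM zZ ->]]] /asboolP[m' [z' [mM' zZ' ->]]]; apply/asboolP.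
exists (a *: m + m'), (a *: z + z'); split; [by rewrite rpredD ?rpredZ.. |].
by rewrite linearP !scalerDr addrACA !scalerA [x * a]mulrC.
Qed.

HB.instance Definition _ := GRing.isSubmodClosed.Build R L Nmod
  (GRing.submod_closed_semi Nmod_closed).

End Setup.

(* Main.v *)
Require Import Defs.
From HB Require Import structures.
From mathcomp Require Import all_boot all_algebra.
From mathcomp Require Import boolp.
From mathcomp Require Import ring.

(** Write [K = alpha L], [J = beta L] and [Z = alpha L + x L]. If [beta m = x w],
    applying [alpha] and cancelling [x] shows that [w] lies in [J], and then that
    [m] lies in [Z]. Conversely [beta (alpha s + x t) = x (beta t)], so that [beta]
    is divisible by [x] on [Z], with quotient [eta]. The exactness of
    [0 -> Z -> M (+) Z -> N -> 0] puts both together ([short_exact_Z_MZ_N]).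

    Degeneration. From [x eta = beta] on [Z] and the nilpotency of [beta] it follows
    that [eta] is nilpotent. Take [V = k[t]_(t)] and deform the inclusion of [Z]
    into [M (+) Z] to [(theta, t + eta)]: at [t = 0] its cokernel is [N], and once
    [t] is inverted, so is [t + eta], and the cokernel becomes [M (x) V_t]. The
    cokernel [Q] is therefore the submodule of [M (x) V_t] generated by [M (x) V]
    and by the elements [tau z = (t + eta)^-1 z], finite sums in powers of [1/t].
    It is torsion-free over [V], hence flat ([torsion_free_flat]). Where
    [e_0] and [e_(-1)] are Laurent coefficients of [e], the map
    [rho e = beta e_0 + x e_(-1)] sends [Q] onto [N] with kernel [t Q]
    ([family_special_fiber]), so that no relation of the tensor product has to be
    analysed.

    Depth. Everything reduces to short exact sequences in which no depth is lost:
    [0 -> K -> L -> J -> 0] and [0 -> J -> L -> K -> 0], by which a sequence that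
    is regular on [L] is regular on [K] and [J] as well
    ([weakly_regular_periodic]); [0 -> K -> Z -> J -> 0], where the second map is
    [eta]; [0 -> J -> beta L + x L -> K -> 0], the same with [alpha] and [beta]
    exchanged; and
    [0 -> M (+) Z -> N (+) L (+) L -> beta L + x L -> 0] ([short_exact_MZ_NLL]),
    which makes [N] a direct summand of an extension. A sequence regular on both
    ends of an extension is regular on the middle, so after localization it
    remains to find a sequence that is regular on [L] and on [M] at once
    ([common_regular_sequence]). This needs prime avoidance
    ([exists_regular]) and the fact that the depth drops by at most one modulo
    any regular element ([depth_ge_add_mult]); nonzero quotients are provided by
    Nakayama's lemma. *)

Set Implicit Arguments.
Unset Strict Implicit.
Unset Printing Implicit Defensive.

Import GRing.Theory.

Local Open Scope ring_scope.

(** * Linear maps and submodules *)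

Definition mk_linear (A : pzRingType) (U V : lmodType A) (f : U -> V)
    (fL : linear f) : {linear U -> V} :=
  HB.pack f (GRing.isLinear.Build A U V *:%R f fL).

Lemma mk_linearE (A : pzRingType) (U V : lmodType A) (f : U -> V)
    (fL : linear f) u : mk_linear fL u = f u.
Proof. by []. Qed.

Definition mk_submod (A : pzRingType) (M : lmodType A) (S : {pred M})
    (H : submod_closed S) : submodClosed M :=
  HB.pack S (GRing.isSubmodClosed.Build A M S (GRing.submod_closed_semi H)).

Lemma linear_scale (A : pzRingType) (U V : lmodType A) (f : {linear U -> V}) a u :
  f (a *: u) = a *: f u.
Proof. exact: linearZ. Qed.

Lemma inj_surj_bij (T U : Type) (f : T -> U) :
  injective f -> (forall u, exists t, f t = u) -> bijective f.
Proof.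
move=> finj fsurj; pose g u := sval (cid (fsurj u)).
have gK : cancel g f by move=> u; rewrite /g; case: cid.
by exists g => // t; apply: finj; rewrite gK.
Qed.

Lemma submod_valP (A : pzRingType) (M : lmodType A) (S : submodClosed M) a
    (u v : submod S) :
  submod_val (a *: u + v) = a *: submod_val u + submod_val v.
Proof. by []. Qed.

Lemma submodB (A : pzRingType) (M : lmodType A) (S : submodClosed M) (u v : M) :
  u \in S -> v \in S -> u - v \in S.
Proof.
by move=> uS vS; apply: (rpredD (S := S)) => //; rewrite -scaleN1r; apply: (rpredZ (s := S)).
Qed.

Section Corestriction.
Variables (A : pzRingType) (U L : lmodType A) (S : submodClosed L).
Variables (h : {linear U -> L}) (hS : forall u, h u \in S).
Definition corestrict (u : U) : submod S := Submod (hS u).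
Fact corestrict_linear : linear corestrict.
Proof. by move=> a u v; apply: val_inj; rewrite /= linearP. Qed.
HB.instance Definition _ := GRing.isLinear.Build A U (submod S) _ corestrict corestrict_linear.
End Corestriction.

Section LinearImage.
Variables (A : pzRingType) (U V : lmodType A) (f : {linear U -> V}).
Definition linear_image : {pred V} := [pred v | `[< exists u, f u = v >]].
Fact linear_image_closed : submod_closed linear_image.
Proof.
split=> [|a _ _ /asboolP[u <-] /asboolP[v <-]]; apply/asboolP.
  by exists 0; rewrite linear0.
by exists (a *: u + v); rewrite linearP.
Qed.
HB.instance Definition _ := GRing.isSubmodClosed.Build A V linear_image
  (GRing.submod_closed_semi linear_image_closed).
Lemma mem_image u : f u \in linear_image.
Proof. by apply/asboolP; exists u. Qed.
End LinearImage.

(** * Short exact sequences attached to the periodic complex *)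

Section PeriodicComplex.
Variables (R : comPzRingType) (L : lmodType R) (alpha beta : {linear L -> L}).
Hypothesis im_alpha : forall l : L, (exists s, alpha s = l) <-> beta l = 0.
Hypothesis im_beta : forall l : L, (exists s, beta s = l) <-> alpha l = 0.
Variables (x : R) (x_reg : regular_element L x).

Local Notation K := (submod (linear_image alpha)).
Local Notation J := (submod (linear_image beta)).
Local Notation Z := (submod (Zmod x alpha)).

Lemma beta_alpha l : beta (alpha l) = 0.
Proof. by apply/im_alpha; exists l. Qed.

Lemma alpha_beta l : alpha (beta l) = 0.
Proof. by apply/im_beta; exists l. Qed.

Lemma x_inj : injective (fun l : L => x *: l).
Proof. by move=> u v e; apply/subr0_eq/x_reg; rewrite scalerBr e subrr. Qed.

Lemma mem_Zmod s t : alpha s + x *: t \in Zmod x alpha.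
Proof. by apply/asboolP; exists s, t. Qed.

(** Applying [alpha] to [beta l = x w] and cancelling [x] gives [alpha w = 0],
    so that [w = beta t] and [beta] kills [l - x t]. *)
Lemma beta_multiple l w : beta l = x *: w -> l \in Zmod x alpha.
Proof.
move=> e; have : alpha w = 0.
  by apply: x_reg; rewrite -linearZ -e /= alpha_beta.
move/im_beta=> [t tw]; have : beta (l - x *: t) = 0.
  by rewrite linearB linearZ /= e tw subrr.
by move/im_alpha=> [s sl]; rewrite -(subrK (x *: t) l) -sl mem_Zmod.
Qed.

Lemma eta_exists (z : Z) : exists w : J, x *: submod_val w = beta (submod_val z).
Proof.
case: z => z zZ; have /asboolP[s [t e]] := zZ.
by exists (Submod (mem_image beta t)); rewrite /= e linearD linearZ /= beta_alpha add0r.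
Qed.

Definition eta_fun (z : Z) : J := sval (cid (eta_exists z)).

Lemma eta_funP z : x *: submod_val (eta_fun z) = beta (submod_val z).
Proof. by rewrite /eta_fun; case: cid. Qed.

Fact eta_fun_linear : linear eta_fun.
Proof.
move=> a u v; apply/val_inj/x_inj.
rewrite eta_funP !submod_valP linearP /= scalerDr -!eta_funP.
by rewrite !scalerA mulrC.
Qed.

(** On [alpha L + x L] the map [beta] is divisible by [x]; this is the quotient,
    with values in [beta L]. *)
Definition etaJ : {linear Z -> J} := mk_linear eta_fun_linear.

Lemma etaJP z : x *: submod_val (etaJ z) = beta (submod_val z).
Proof. exact: eta_funP. Qed.

Lemma etaJE s t z :
  submod_val z = alpha s + x *: t -> submod_val (etaJ z) = beta t.
Proof.
move=> e; apply: x_inj; rewrite etaJP e linearD linearZ /=.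
by rewrite beta_alpha add0r.
Qed.

Lemma alpha_in_Z l : alpha l \in Zmod x alpha.
Proof. by have := mem_Zmod l 0; rewrite scaler0 addr0. Qed.

Lemma xL_in_Z l : x *: l \in Zmod x alpha.
Proof. by have := mem_Zmod 0 l; rewrite linear0 add0r. Qed.

Lemma KZ (k : K) : submod_val k \in Zmod x alpha.
Proof. by case: k => k /= /asboolP[s <-]; apply: alpha_in_Z. Qed.

(** Used again with [alpha] and [beta] exchanged: [alpha L] and [beta L] are
    syzygies of each other. *)
Lemma short_exact_KLJ :
  exists (f : {linear K -> L}) (g : {linear L -> J}), short_exact f g.
Proof.
exists \val, (corestrict (mem_image beta)); split; first exact: val_inj.
  move=> m; split=> [/(congr1 val) /= /im_alpha sm|[[k kK] /= <-]].
    have mK : m \in linear_image alpha by apply/asboolP.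
    by exists (Submod mK).
  by apply: val_inj; case/asboolP: kK => s <-; rewrite /= beta_alpha.
by case=> l lJ; case/asboolP: (lJ) => s sl; exists s; apply: val_inj.
Qed.

(** As [x] is regular, [etaJ] has the same kernel [alpha L] as [beta], and it is
    onto because [x l] goes to [beta l]. So [alpha L + x L] is an extension of
    [beta L] by [alpha L], and [beta L + x L], by symmetry, one of [alpha L] by
    [beta L]. *)
Lemma short_exact_KZJ :
  exists (f : {linear K -> Z}) (g : {linear Z -> J}), short_exact f g.
Proof.
exists (@corestrict R K L (Zmod x alpha) \val KZ), etaJ; split.
- by move=> u v [/val_inj].
- move=> z; split=> [e|[k <-]].
    have : beta (submod_val z) = 0 by rewrite -etaJP e scaler0.
    move/im_alpha => zK.
    have zK' : submod_val z \in linear_image alpha by apply/asboolP.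
    by exists (Submod zK'); apply: val_inj.
  apply: val_inj; apply: x_inj; rewrite etaJP /= scaler0.
  by case: k => k /= /asboolP[s <-]; rewrite beta_alpha.
case=> l lJ; case/asboolP: (lJ) => s sl; exists (Submod (xL_in_Z s)).
by apply/val_inj/x_inj; rewrite etaJP /= linearZ /= sl.
Qed.

End PeriodicComplex.

Section Extension.
Variables (R : comPzRingType) (L : lmodType R) (alpha beta : {linear L -> L}).
Hypothesis im_alpha : forall l : L, (exists s, alpha s = l) <-> beta l = 0.
Hypothesis im_beta : forall l : L, (exists s, beta s = l) <-> alpha l = 0.
Variables (x : R) (x_reg : regular_element L x).
Hypothesis beta_Z : forall l : L, beta l \in Zmod x alpha.
Variables (M : submodClosed L) (Z_M : {subset Zmod x alpha <= M}).

Local Notation Z := (submod (Zmod x alpha)).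
Local Notation Z' := (submod (Zmod x beta)).
Local Notation N := (submod (Nmod x alpha beta M)).

Lemma J_Z (j : submod (linear_image beta)) : submod_val j \in Zmod x alpha.
Proof. by case: j => j /= /asboolP[s <-]. Qed.

Definition etaZ : {linear Z -> Z} :=
  @corestrict R _ L (Zmod x alpha) \val J_Z \o @etaJ R L alpha beta im_alpha x x_reg.

Lemma etaZP z : x *: submod_val (etaZ z) = beta (submod_val z).
Proof. exact: etaJP. Qed.

Lemma mem_Nmod m z : m \in M -> z \in Zmod x alpha ->
  beta m + x *: z \in Nmod x alpha beta M.
Proof. by move=> mM zZ; apply/asboolP; exists m, z. Qed.

(** Exactness in the middle is [beta_multiple]: if [beta m = x z], then [m] lies
    in [Z] and [z = eta m]. *)
Lemma short_exact_Z_MZ_N :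
  exists (theta : {linear Z -> submod M}) (eta : {linear Z -> Z})
         (f : {linear Z -> (submod M * Z)%type}) (g : {linear (submod M * Z)%type -> N}),
    [/\ forall z : Z, submod_val (theta z) = submod_val z,
        forall (s t : L) (z : Z),
          submod_val z = alpha s + x *: t -> submod_val (eta z) = beta t,
        forall z : Z, f z = (theta z, eta z),
        forall (m : submod M) (z : Z), submod_val (g (m, z)) = beta (submod_val m) - x *: submod_val z &
        short_exact f g].
Proof.
pose theta : {linear Z -> submod M} :=
  @corestrict R Z L M \val (fun z => Z_M (submodP z)).
have fL : linear (fun z : Z => (theta z, etaZ z)).
  by move=> a u v; rewrite !linearP.
have gL : linear (fun p : submod M * Z =>
    beta (submod_val p.1) - x *: submod_val p.2).
  move=> a [m z] [m' z'] /=.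
  rewrite linearP /= scalerDr !scalerBr !scalerA [x * a]mulrC.
  by rewrite opprD addrACA.
have gN (p : submod M * Z) : mk_linear gL p \in Nmod x alpha beta M.
  case: p => m z; rewrite mk_linearE /= -scalerN.
  by apply: mem_Nmod (submodP m) _; rewrite rpredN submodP.
exists theta, etaZ, (mk_linear fL), (corestrict gN); split=> //.
  by move=> s t z e; apply: (etaJE _ x_reg e).
split=> [u v|[m z]|[n nN]].
- by move=> /(congr1 (fun p : submod M * Z => submod_val p.1)) /= /val_inj.
- split=> [/(congr1 val) /= /subr0_eq e|[w [<- <-]]].
    have mZ : submod_val m \in Zmod x alpha.
      exact: (beta_multiple im_alpha im_beta x_reg e).
    exists (Submod mZ); congr (_, _); apply: val_inj => //.
    by apply: (x_inj x_reg); rewrite etaZP.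
  by apply: val_inj; rewrite /= etaZP subrr.
case/asboolP: (nN) => m [z [mM zZ e]].
exists (Submod mM, - Submod zZ); apply: val_inj.
by rewrite /= scalerN opprK.
Qed.

(** This sequence presents [N] as a direct summand of an extension of
    [beta L + x L] by [M (+) Z], to which regular sequences extend; the sequence
    [0 -> Z -> M (+) Z -> N -> 0] alone would lose one from the depth of [N]. The
    map onto [beta L + x L] is [(n, l, l') |-> n + (beta l' + x l)]. If
    [n = beta m + x z] and this value is zero, then
    [beta (l' + m) = - x (l + z)], so [l' + m] lies in [Z] and [l + z] in
    [beta L]: hence [l'] lies in [M] and [l] in [Z], and the pair [(l', l)]
    determines [n]. *)
Lemma short_exact_MZ_NLL :
  exists (f : {linear (submod M * Z)%type -> (N * (L * L))%type})
         (g : {linear (N * (L * L))%type -> Z'}), short_exact f g.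
Proof.
have gL : linear (fun p : N * (L * L) =>
    submod_val p.1 + (beta p.2.2 + x *: p.2.1)).
  move=> a [n [l l']] [m [k k']] /=.
  rewrite linearP /= !scalerDr !scalerA [x * a]mulrC.
  by rewrite [X in _ + X = _]addrACA [LHS]addrACA.
have gZ p : mk_linear gL p \in Zmod x beta.
  case: p => -[n nN] [l l']; rewrite mk_linearE /=.
  case/asboolP: nN => m [z [_ _ ->]].
  rewrite addrACA -linearD -scalerDr; apply: mem_Zmod.
have fN (p : submod M * Z) : - (beta (submod_val p.1) + x *: submod_val p.2) \in Nmod x alpha beta M.
  by rewrite rpredN; apply: mem_Nmod; apply: submodP.
have fL : linear (fun p : submod M * Z =>
    (Submod (fN p) : N, (submod_val p.2, submod_val p.1))).
  move=> a [m z] [m' z'].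
  apply: injective_projections => /=; last by [].
  apply: val_inj => /=.
  rewrite linearP /= scalerN -opprD; congr (- _).
  by rewrite !scalerDr !scalerA [x * a]mulrC addrACA.
exists (mk_linear fL), (corestrict gZ); split.
- move=> [m z] [m' z'] /(congr1 snd) /= [/val_inj -> /val_inj ->] //.
- case=> n [l l']; split=> [/(congr1 val)|[[m z]]]; last first.
    by move=> <-; apply: val_inj; rewrite /= addNr.
  case: n => n nN /= e0; case/asboolP: (nN) => m [z [mM zZ En]].
  have {}e : beta (l' + m) = x *: (- (l + z)).
    apply/eqP; rewrite -subr_eq0 scalerN opprK linearD scalerDr addrACA.
    by rewrite -En addrC e0.
  have mZ := beta_multiple im_alpha im_beta x_reg e.
  have l'M : l' \in M.
    by rewrite -(addrK m l'); apply: submodB; [apply: Z_M | ].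
  have lZ : l \in Zmod x alpha.
    have : - (l + z) = submod_val (etaZ (Submod mZ)).
      by apply: (x_inj x_reg); rewrite etaZP.
    move=> lz; rewrite -(addrK z l); apply: submodB => //.
    by rewrite -rpredN lz submodP.
  exists (Submod l'M, Submod lZ); apply: injective_projections => //=.
  apply: val_inj => /=.
  by apply/esym/eqP; rewrite -addr_eq0 e0.
- case=> z' /= zZ'; case/asboolP: (zZ') => s [t e].
  by exists (0, (t, s)); apply: val_inj; rewrite /= add0r.
Qed.
End Extension.

(** * Finite generation over noetherian rings *)

Section Submodules.
Variables (A : comPzRingType).

(** Submodules as propositional predicates: those below are mostly given by
    existential statements. *)
Definition is_submod (U : lmodType A) (S : U -> Prop) : Prop :=
  S 0 /\ forall a u v, S u -> S v -> S (a *: u + v).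

Lemma is_submodD (U : lmodType A) (S : U -> Prop) u v :
  is_submod S -> S u -> S v -> S (u + v).
Proof. by case=> _ H uS vS; rewrite -[u]scale1r; apply: H. Qed.

Lemma is_submodZ (U : lmodType A) (S : U -> Prop) a u :
  is_submod S -> S u -> S (a *: u).
Proof. by case=> H0 H uS; rewrite -[_ *: _]addr0; apply: H. Qed.

Lemma is_submodN (U : lmodType A) (S : U -> Prop) u :
  is_submod S -> S u -> S (- u).
Proof. by move=> H uS; rewrite -scaleN1r; apply: is_submodZ. Qed.

Lemma is_submodB (U : lmodType A) (S : U -> Prop) u v :
  is_submod S -> S u -> S v -> S (u - v).
Proof. by move=> H uS vS; apply: is_submodD => //; apply: is_submodN. Qed.

Lemma is_submod_sum (U : lmodType A) (S : U -> Prop) (I : Type) (r : seq I) F :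
  is_submod S -> (forall i, S (F i)) -> S (\sum_(i <- r) F i).
Proof.
move=> HS HF; apply: big_ind => //; first by case: HS.
by move=> u v; apply: is_submodD.
Qed.

(** Recursive in the generators, for arguments that remove one generator at a
    time. *)
Fixpoint in_span (U : lmodType A) (g : seq U) (u : U) : Prop :=
  if g is v :: g' then exists a, in_span g' (u - a *: v) else u = 0.

Lemma in_span_submod (U : lmodType A) (g : seq U) : is_submod (in_span g).
Proof.
elim: g => [|v g [IH0 IH]] /=; split => //.
- by move=> a u v -> ->; rewrite scaler0 addr0.
- by exists 0; rewrite scale0r subr0.
move=> a u w [b ub] [c wc]; exists (a * b + c).
rewrite scalerDl opprD addrACA -scalerA -scalerBr.
exact: IH.
Qed.

Lemma in_span_mem (U : lmodType A) (g : seq U) u : u \in g -> in_span g u.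
Proof.
elim: g => //= v g IH; rewrite inE => /orP[/eqP ->|/IH ug].
  by exists 1; rewrite scale1r subrr; case: (in_span_submod g).
by exists 0; rewrite scale0r subr0.
Qed.

Lemma in_span_min (U : lmodType A) (g : seq U) (S : U -> Prop) :
  is_submod S -> (forall u, u \in g -> S u) -> forall u, in_span g u -> S u.
Proof.
move=> HS; elim: g => /= [_ u ->|v g IH Hg u [a ua]]; first by case: HS.
rewrite -(subrK (a *: v) u); apply: is_submodD => //.
  by apply: IH ua => w wg; apply: Hg; rewrite inE wg orbT.
by apply: is_submodZ => //; apply: Hg; rewrite inE eqxx.
Qed.

Lemma in_span_sub (U : lmodType A) (g h : seq U) :
  {subset g <= h} -> forall u, in_span g u -> in_span h u.
Proof.
move=> gh; apply: in_span_min => [|u ug]; first exact: in_span_submod.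
exact/in_span_mem/gh.
Qed.

Lemma fg_in_span (U : lmodType A) :
  finitely_generated U -> exists g : seq U, forall u, in_span g u.
Proof.
case=> n [g Hg]; exists [seq g i | i <- enum 'I_n] => u.
have [a ->] := Hg u; apply: is_submod_sum => [|i]; first exact: in_span_submod.
apply: is_submodZ; first exact: in_span_submod.
by apply: in_span_mem; apply: map_f; rewrite mem_enum.
Qed.

Lemma in_span_sum (U : lmodType A) (g : seq U) u :
  in_span g u -> exists a : 'I_(size g) -> A, u = \sum_i a i *: g`_i.
Proof.
elim: g u => [u ->|v g IH u [a /IH[b e]]] /=.
  by exists (fun=> 0); rewrite big_ord0.
exists (fun i => if unlift ord0 i is Some j then b j else a).
rewrite big_ord_recl unlift_none /= -(subrK (a *: v) u) e addrC.
by congr (_ + _); apply: eq_bigr => i _; rewrite liftK.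
Qed.

Lemma in_span_fg (U : lmodType A) (g : seq U) :
  (forall u, in_span g u) -> finitely_generated U.
Proof. by move=> H; exists (size g), (fun i => g`_i) => u; apply: in_span_sum. Qed.

Definition fg_sub (U : lmodType A) (S : U -> Prop) : Prop :=
  exists g : seq U, (forall u, u \in g -> S u) /\ forall u, S u -> in_span g u.

Definition noeth : Prop := forall I : A^o -> Prop, is_submod I -> fg_sub I.

Lemma noetherian_noeth : noetherian A -> noeth.
Proof.
move=> HA I HI; pose S : {pred A^o} := [pred a | `[< I a >]].
have HS : submod_closed S.
  split=> [|a u v /asboolP uI /asboolP vI]; apply/asboolP; first by case: HI.
  by case: HI => _; apply.
have [g Hg] := fg_in_span (HA (mk_submod HS)).
exists (map val g); split=> [u /mapP[[v vS] _ ->] /=|u uI]; first exact/asboolP.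
have uS : u \in mk_submod HS by apply/asboolP.
suff: in_span (map val g) (val (Submod uS)) by [].
move: (Submod uS) (Hg (Submod uS)) => u'; move: u'.
apply: (in_span_min (S := fun v => in_span (map val g) (val v))).
  split=> [|a v w vg wg]; first by case: (in_span_submod (map val g)).
  by case: (in_span_submod (map val g)) => _; apply.
by move=> v vg; apply/in_span_mem/map_f.
Qed.

Hypothesis nA : noeth.

(** Induction on the number of generators: the coefficients with which the first
    generator occurs in elements of [S] form an ideal; finitely many elements of
    [S] realize generators of this ideal, and the rest of [S] is spanned by the
    remaining generators. *)
Lemma fg_subs (U : lmodType A) (g : seq U) (S : U -> Prop) :
  is_submod S -> (forall u, S u -> in_span g u) -> fg_sub S.
Proof.
elim: g S => [|v g IH] S HS Sg; first by exists [::].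
pose I a := exists2 s, S s & in_span g (s - a *: v).
have HI : is_submod (I : A^o -> Prop).
  split=> [|a b c [s Ss sb] [s' Ss' sc]].
    exists 0; first by case: HS.
    by rewrite scale0r subr0; case: (in_span_submod g).
  exists (a *: s + s'); first by case: HS => _; apply.
  rewrite scalerDl opprD addrACA -[(a *: b) *: v]scalerA -scalerBr.
  by case: (in_span_submod g) => _; apply.
have [l [lI Il]] := nA HI.
have /choice[F FP] a : exists s, I a -> S s /\ in_span g (s - a *: v).
  by have [[s ? ?]|nI] := pselect (I a); [exists s | exists 0].
have HS' : is_submod (fun u => S u /\ in_span g u).
  split; first by split; [case: HS | case: (in_span_submod g)].
  by move=> a u w [? ?] [? ?]; split;
    [case: HS => _; apply | case: (in_span_submod g) => _; apply].
have [h [hS Sh]] := IH _ HS' (fun u H => H.2).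
exists (map F l ++ h); split=> [u|u Su].
  rewrite mem_cat => /orP[/mapP[a /lI aI ->]|/hS[] //]; exact: (FP a aI).1.
have [a ua] := Sg u Su.
have /Il al : I a by exists u.
have [w wF wa] : exists2 w, in_span (map F l) w & in_span g (w - a *: v).
  apply: (in_span_min (U := A^o) (S := fun a : A => exists2 w, in_span (map F l) w &
    in_span g (w - a *: v)) _ _ al).
    split=> [|d b c [s Ss sb] [s' Ss' sc]].
      exists 0; first by case: (in_span_submod (map F l)).
      by rewrite scale0r subr0; case: (in_span_submod g).
    exists (d *: s + s'); first by case: (in_span_submod (map F l)) => _; apply.
    rewrite scalerDl opprD addrACA -[(d *: b) *: v]scalerA -scalerBr.
    by case: (in_span_submod g) => _; apply.
  move=> b bl; exists (F b); last by have [] := FP b (lI _ bl).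
  by apply/in_span_mem/map_f.
have Sw : S w.
  move: wF; apply: in_span_min => // _ /mapP[b /lI bI ->]; exact: (FP b bI).1.
rewrite -(subrK w u); apply: is_submodD.
- exact: in_span_submod.
- apply: (@in_span_sub _ h) => [b bh|]; first by rewrite mem_cat bh orbT.
  apply: Sh; split; first exact: is_submodB.
  have -> : u - w = (u - a *: v) - (w - a *: v) by rewrite opprB addrA subrK.
  by apply: is_submodB => //; apply: in_span_submod.
by apply: (@in_span_sub _ (map F l)) => // b bh; rewrite mem_cat bh.
Qed.

(** An infinite strictly ascending chain of ideals would have a union that is
    not finitely generated. *)
Lemma noeth_maximal (T : Type) (D : T -> Prop) (I : T -> A^o -> Prop) t0 :
  (forall t, is_submod (I t)) -> D t0 ->
  exists t, [/\ D t, forall a, I t0 a -> I t a &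
    forall t', D t' -> (forall a, I t a -> I t' a) -> forall a, I t' a -> I t a].
Proof.
move=> HI D0; apply: contrapT => nomax.
have /choice[f fP] t : exists t', D t -> (forall a, I t0 a -> I t a) ->
    [/\ D t', forall a, I t a -> I t' a & exists2 a, I t' a & ~ I t a].
  apply: contrapT => H; apply: nomax; exists t.
  have Dt : D t by apply: contrapT => nD; apply: H; exists t.
  have le0 : forall a, I t0 a -> I t a.
    by apply: contrapT => nD; apply: H; exists t.
  split=> // t' Dt' le a a't; apply: contrapT => nIa.
  by apply: H; exists t' => _ _; split=> //; exists a.
pose s n := iter n f t0.
have sP n : D (s n) /\ (forall a, I t0 a -> I (s n) a).
  elim: n => [//|n [Dn len]] /=; have [D' le' _] := fP _ Dn len.
  by split=> // a /len /le'.
have sS n a : I (s n) a -> I (s n.+1) a.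
  by have [Dn len] := sP n; have [_ le' _] := fP _ Dn len; apply: le'.
have sle m n a : (m <= n)%N -> I (s m) a -> I (s n) a.
  by move/subnK <-; elim: (n - m)%N => // d IH /IH; rewrite addSn; apply: sS.
have HU : is_submod (fun a => exists n, I (s n) a).
  split=> [|a b c [m bm] [n cn]]; first by exists 0%N; case: (HI (s 0%N)).
  exists (maxn m n); case: (HI (s (maxn m n))) => _; apply.
    by apply: sle bm; apply: leq_maxl.
  by apply: sle cn; apply: leq_maxr.
have [g [gU Ug]] := nA HU.
have [n gn] : exists n, forall a, a \in g -> I (s n) a.
  elim: g gU {Ug} => [|a g IH] gU; first by exists 0%N.
  have [|n Hn] := IH; first by move=> b bg; apply: gU; rewrite inE bg orbT.
  have [|m Hm] := gU a; first by rewrite inE eqxx.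
  exists (maxn m n) => b; rewrite inE => /orP[/eqP ->|/Hn].
    by apply: sle Hm; apply: leq_maxl.
  by apply: sle; apply: leq_maxr.
have [Dn len] := sP n; have [_ _ [a an]] := fP _ Dn len; apply.
by apply: (in_span_min (HI _) gn); apply: Ug; exists n.+1.
Qed.

End Submodules.

Section FinitelyGeneratedSubmodules.
Variables (A : comPzRingType) (L : lmodType A) (S : submodClosed L).

Lemma in_span_submod_val (h : seq (submod S)) u :
  in_span (map (@submod_val _ _ S) h) (submod_val u) -> in_span h u.
Proof.
elim: h u => [u e|v h IH u /= [a ua]]; first exact: val_inj.
by exists a; apply: IH.
Qed.

Lemma submod_seq (g : seq L) : (forall u, u \in g -> u \in S) ->
  exists h : seq (submod S), map (@submod_val _ _ S) h = g.
Proof.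
elim: g => [|u g IH] gS; first by exists [::].
have [|h <-] := IH; first by move=> v vg; apply: gS; rewrite inE vg orbT.
have uS : u \in S by apply: gS; rewrite inE eqxx.
by exists (Submod uS :: h).
Qed.

Lemma submod_in_span (g : seq L) : noeth A -> (forall l, in_span g l) ->
  exists h : seq (submod S), forall u, in_span h u.
Proof.
move=> nA gP; have SI : is_submod (fun l => l \in S).
  by split=> [|a u v uS vS]; [apply: rpred0 | rewrite rpredD ?rpredZ].
have [g' [g'S Sg']] := fg_subs nA SI (fun u _ => gP u).
have [h hg'] := submod_seq g'S.
exists h => u; apply: in_span_submod_val; rewrite hg'.
by apply: Sg'; apply: submodP.
Qed.

End FinitelyGeneratedSubmodules.



(** * Torsion-free modules over a discrete valuation ring are flat *)

Lemma tensor_of_sum (k : comPzRingType) (M N : lmodType k) (s : seq (M * N)) :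
  tensor_of s = \sum_(p <- s) tens p.1 p.2.
Proof.
elim: s => [|[m n] s IH]; first by rewrite big_nil.
by rewrite big_cons -IH -cat1s tensor_ofD.
Qed.

Lemma tens0l (k : comPzRingType) (M N : lmodType k) (n : N) :
  tens (0 : M) n = 0.
Proof. by apply: (addrI (tens 0 n)); rewrite -tensDl !addr0. Qed.

Lemma tens_suml (k : comPzRingType) (M N : lmodType k) I (r : seq I) (F : I -> M)
  (n : N) : tens (\sum_(i <- r) F i) n = \sum_(i <- r) tens (F i) n.
Proof.
by elim/big_rec2: _ => [|i u v _ <-]; rewrite (tens0l, tensDl).
Qed.

Lemma tens0r (k : comPzRingType) (M N : lmodType k) (m : M) :
  tens m (0 : N) = 0.
Proof. by apply: (addrI (tens m 0)); rewrite -tensDr !addr0. Qed.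

Lemma tens_sumr (k : comPzRingType) (M N : lmodType k) I (r : seq I) (F : I -> N)
  (m : M) : tens m (\sum_(i <- r) F i) = \sum_(i <- r) tens m (F i).
Proof.
by elim/big_rec2: _ => [|i u v _ <-]; rewrite (tens0r, tensDr).
Qed.

Section DiscreteValuation.
Variables (V : idomainType) (t : V).
Hypothesis t_neq0 : t != 0.
Hypothesis t_nonunit : forall v, t * v != 1.
Hypothesis decomp : forall v, v != 0 ->
  exists n u, u \is a GRing.unit /\ v = t ^+ n * u.

Lemma nonunit_multiple v : (v \isn't a GRing.unit) <-> exists w, v = t * w.
Proof.
split=> [vu|[w ->]]; last first.
  rewrite unitrM negb_and; apply/orP; left; apply/negP => tu.
  by have := t_nonunit t^-1; rewrite divrr ?eqxx.
have [->|v0] := eqVneq v 0; first by exists 0; rewrite mulr0.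
have [[|n] [u [uu e]]] := decomp v0.
  by rewrite e expr0 mul1r uu in vu.
by exists (t ^+ n * u); rewrite e exprS mulrA.
Qed.

(** A nonzero ideal is generated by the least power of [t] that it contains. *)
Lemma decomp_dvr : dvr_uniformizer t.
Proof.
split=> [I||]; [|exact: t_neq0|exact: nonunit_multiple].
have [[v vI v0]|nI] := pselect (exists2 v : V, v \in I & v != 0); last first.
  exists 0 => v; split=> [vI|[w ->]]; last by rewrite mul0r; apply: rpred0.
  exists 0; rewrite mulr0; apply/eqP; apply: contrapT => /negP v0.
  by apply: nI; exists v.
have exn : exists n, (t ^+ n : V^o) \in I.
  have [n [u [uu e]]] := decomp v0; exists n.
  by rewrite -(mulrK uu (t ^+ n)) -e mulrC; apply: rpredZ.
have [n tn nmin] := ex_minnP exn; exists (t ^+ n) => w.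
split=> [wI|[u ->]]; last by rewrite mulrC; apply: rpredZ.
have [->|w0] := eqVneq w 0; first by exists 0; rewrite mulr0.
have [m [u [uu e]]] := decomp w0; exists (t ^+ (m - n) * u).
rewrite mulrA -exprD subnKC //; apply: nmin.
by rewrite -(mulrK uu (t ^+ m)) -e mulrC; apply: rpredZ.
Qed.

(** The entry of least valuation divides all others. *)
Lemma unimodular (m : nat) (v : 'I_m -> V) i0 : v i0 != 0 ->
  exists d (u : 'I_m -> V), [/\ d != 0, forall i, v i = d * u i &
    exists j, u j \is a GRing.unit].
Proof.
move=> v0.
pose P n := `[< exists j u, u \is a GRing.unit /\ v j = t ^+ n * u >].
have exn : exists n, P n.
  by have [n [u [uu e]]] := decomp v0; exists n; apply/asboolP; exists i0, u.
have [n /asboolP[j [u0 [u0u e0]]] nmin] := ex_minnP exn.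
have /choice[u uP] i : exists u, v i = t ^+ n * u.
  have [->|vi] := eqVneq (v i) 0; first by exists 0; rewrite mulr0.
  have [m' [u [uu e]]] := decomp vi; exists (t ^+ (m' - n) * u).
  rewrite mulrA -exprD subnKC //; apply: nmin.
  by apply/asboolP; exists i, u.
exists (t ^+ n), u; split=> //; first by rewrite expf_neq0.
exists j; suff -> : u j = u0 by [].
by apply: (@mulfI _ (t ^+ n)); rewrite ?expf_neq0 // -uP.
Qed.

Section TorsionFree.
Variable Q : lmodType V.
Hypothesis torsion_free : forall q : Q, t *: q = 0 -> q = 0.

Lemma scale_neq0_inj d (q : Q) : d != 0 -> d *: q = 0 -> q = 0.
Proof.
move=> d0; have [n [u [uu ->]]] := decomp d0; rewrite mulrC -scalerA.
move/(congr1 (fun q => u^-1 *: q)) => /=; rewrite [u^-1 *: _]scalerA mulVr // scale1r scaler0.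
elim: n => [|n IH]; first by rewrite expr0 scale1r.
by rewrite exprS -scalerA => /torsion_free.
Qed.

Definition independent (w : seq Q) : Prop := forall a : 'I_(size w) -> V,
  \sum_i a i *: w`_i = 0 -> forall i, a i = 0.

(** In a linear relation, divided by its coefficient of least valuation, some
    vector has an invertible coefficient and can be eliminated. *)
Lemma independent_generators (g : seq Q) :
  exists2 w, independent w & forall q, in_span g q -> in_span w q.
Proof.
have [n] := ubnP (size g); elim: n g => // n IH g; rewrite ltnS => gn.
have [ig|nig] := pselect (independent g); first by exists g.
have [a a0 [i0 ai0]] : exists2 a : 'I_(size g) -> V, \sum_i a i *: g`_i = 0 &
    exists i, a i != 0.
  apply: contrapT => H; apply: nig => a a0 i; apply/eqP; apply: contrapT => ai.
  by apply: H; exists a => //; exists i; apply/negP.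
have [d [u [d0 au [j uj]]]] := unimodular ai0.
have u0 : \sum_i u i *: g`_i = 0.
  apply: (scale_neq0_inj d0); rewrite scaler_sumr -[RHS]a0.
  by apply: eq_bigr => i _; rewrite scalerA au.
pose g' := take j g ++ drop j.+1 g.
have szg : size g' = (size g).-1.
  rewrite size_cat size_take size_drop ltn_ord subnS.
  by case: (size g) j {u uj a a0 i0 ai0 au u0 g'} => [[]//|m] j /=; rewrite subSKn subnKC // -ltnS.
have gi (i : 'I_(size g)) : i != j -> in_span g' g`_i.
  move=> ij; apply: in_span_mem; rewrite mem_cat.
  have : i != j :> nat by []; rewrite neq_ltn => /orP[lt|lt].
    by rewrite -(nth_take 0 lt) mem_nth // size_take ltn_ord.
  have e : (j.+1 + (i - j.+1))%N = i by rewrite subnKC.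
  by rewrite -[in g`_i]e -nth_drop mem_nth ?orbT // size_drop ltn_sub2r // (leq_ltn_trans lt).
have gj : in_span g' g`_j.
  rewrite -[g`_j]scale1r -(mulVr uj) -scalerA.
  apply: is_submodZ; first exact: in_span_submod.
  have -> : u j *: g`_j = - \sum_(i | i != j) u i *: g`_i.
    by apply/eqP; rewrite -addr_eq0; rewrite (bigD1 j) //= in u0; apply/eqP.
  apply: is_submodN; first exact: in_span_submod.
  rewrite big_mkcond; apply: is_submod_sum => [|i]; first exact: in_span_submod.
  case: ifP => ij; first by apply: is_submodZ; [apply: in_span_submod | apply: gi].
  by case: (in_span_submod g').
have [|w iw wP] := IH g'.
  by rewrite szg; case: (size g) gn j {u uj a a0 i0 ai0 au u0 g' szg gi gj} => [_ []//|].
exists w => // q gq; apply: wP; apply: in_span_min gq; first exact: in_span_submod.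
move=> _ /(nthP 0)[i ig <-]; have [ij|] := eqVneq (Ordinal ig) j.
  by have -> : i = j by rewrite -ij.
exact: (gi (Ordinal ig)).
Qed.

Definition coordinates (w : seq Q) (c : Q -> 'I_(size w) -> V) : Prop :=
  forall q, in_span w q -> q = \sum_i c q i *: w`_i.

Lemma coordinates_exist w : exists c, @coordinates w c.
Proof.
suff /choice[c cP] q : exists a : 'I_(size w) -> V,
    in_span w q -> q = \sum_i a i *: w`_i by exists c.
have [/in_span_sum[a e]|nq] := pselect (in_span w q); first by exists a.
by exists (fun=> 0).
Qed.

Section Coordinates.
Variables (w : seq Q) (c : Q -> 'I_(size w) -> V).
Hypotheses (iw : independent w) (cP : coordinates c).

Lemma coordinate_unique q (a : 'I_(size w) -> V) :
  in_span w q -> q = \sum_i a i *: w`_i -> forall i, c q i = a i.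
Proof.
move=> wq e i; apply/subr0_eq; move: i; apply: iw.
rewrite (eq_bigr (fun i => c q i *: w`_i - a i *: w`_i)); last first.
  by move=> i _; rewrite scalerBl.
by rewrite sumrB -cP // -e subrr.
Qed.

Lemma coordinateP d q q' : in_span w q -> in_span w q' ->
  forall i, c (d *: q + q') i = d * c q i + c q' i.
Proof.
move=> wq wq'; apply: coordinate_unique.
  by case: (in_span_submod w) => _; apply.
rewrite [in LHS](cP wq) [in LHS](cP wq') scaler_sumr -big_split /=.
by apply: eq_bigr => i _; rewrite scalerDl scalerA.
Qed.

Lemma coordinate0 i : c 0 i = 0.
Proof.
move: i; apply: coordinate_unique; first by case: (in_span_submod w).
by rewrite big1 // => i _; rewrite scale0r.
Qed.

Definition tensor_coord (E : lmodType V) (s : seq (Q * E)) (j : 'I_(size w)) : E :=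
  \sum_(p <- s) c p.1 j *: p.2.

Lemma tensor_of_coord (E : lmodType V) (s : seq (Q * E)) :
  (forall p, p \in s -> in_span w p.1) ->
  tensor_of s = \sum_(j < size w) tens w`_j (tensor_coord s j).
Proof.
move=> ws; rewrite tensor_of_sum.
rewrite (eq_bigr (fun j : 'I_(size w) => \sum_(p <- s) tens (w`_j) (c p.1 j *: p.2))).
  rewrite exchange_big /= big_seq [RHS]big_seq; apply: eq_bigr => p /ws wp.
  rewrite {1}(cP wp) tens_suml; apply: eq_bigr => j _.
  by rewrite tensZ.
by move=> j _; rewrite tens_sumr.
Qed.

End Coordinates.

(** The defining relations of the tensor product respect coordinates, as soon as
    the independent family spans the finitely many vectors they involve. *)
Lemma tensor_eq_coord (E : lmodType V) (s s' : seq (Q * E)) : tensor_eq s s' ->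
  exists g : seq Q, forall w (c : Q -> 'I_(size w) -> V),
    independent w -> coordinates c -> (forall q, q \in g -> in_span w q) ->
    forall j, tensor_coord c s j = tensor_coord c s' j.
Proof.
elim=> {s s'} [s|s s' _ [g H]|s s' s'' _ [g H] _ [g' H']|
    s s' u u' _ [g H] _ [g' H']|s s'|n|m m' n|m n n'|a m n].
- by exists [::].
- by exists g => w c iw cP gw j; rewrite (H w c).
- exists (g ++ g') => w c iw cP gw j; rewrite (H w c) // ?(H' w c) // => q qg.
    by apply: gw; rewrite mem_cat qg orbT.
  by apply: gw; rewrite mem_cat qg.
- exists (g ++ g') => w c iw cP gw j; rewrite /tensor_coord !big_cat /=.
  congr (_ + _); [apply: H | apply: H'] => // q qg; apply: gw.
    by rewrite mem_cat qg.
  by rewrite mem_cat qg orbT.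
- by exists [::] => w c iw cP _ j; rewrite /tensor_coord !big_cat /= addrC.
- exists [::] => w c iw cP _ j.
  by rewrite /tensor_coord big_seq1 big_nil coordinate0 ?scale0r.
- exists [:: m; m'] => w c iw cP gw j.
  rewrite /tensor_coord !big_cons !big_nil /= !addr0 -scalerDl; congr (_ *: _).
  rewrite -[m in LHS]scale1r coordinateP ?mul1r //; apply: gw; rewrite !inE eqxx ?orbT //.
- by exists [::] => w c iw cP _ j; rewrite /tensor_coord !big_cons !big_nil /= !addr0 scalerDr.
exists [:: m] => w c iw cP gw j; rewrite /tensor_coord !big_seq1 /= scalerA.
rewrite -[a *: m]addr0 coordinateP ?coordinate0 ?addr0 1?mulrC //.
  by apply: gw; rewrite inE.
by case: (in_span_submod w).
Qed.

(** A relation in [Q (x) F] involves finitely many elements of [Q], which lie in a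
    free submodule. There a tensor is given by its coordinates, and these commute
    with the injective map [f]. *)
Lemma torsion_free_flat : flat Q.
Proof.
move=> E F f finj.
have fbal : balanced (fun (q : Q) (e : E) => tens q (f e)).
  split=> [q q' e|q e e'|a q e]; first exact: tensDl.
    by rewrite linearD tensDr.
  by rewrite tensZ linearZ.
have fE s : @tensor_map_r V Q E F f (tensor_of s) =
    tensor_of [seq (p.1, f p.2) | p <- s].
  by rewrite /tensor_map_r (tensor_lift_of fbal) tensor_of_sum big_map.
move=> x y; have [s ->] := tensor_ofP x; have [s' ->] := tensor_ofP y.
rewrite !fE => /tensor_of_eq /tensor_eq_coord[g gP].
have [w iw wP] := independent_generators (g ++ map fst s ++ map fst s').
have [c cP] := coordinates_exist w.
rewrite !(tensor_of_coord cP).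
- apply: eq_bigr => j _; congr tens; apply: finj.
  have gw q : q \in g -> in_span w q.
    by move=> qg; apply/wP/in_span_mem; rewrite mem_cat qg.
  have := gP w c iw cP gw j; rewrite /tensor_coord !big_map /= => e.
  rewrite !linear_sum /= (eq_bigr (fun p => c p.1 j *: f p.2)) ?e; last first.
    by move=> p _; rewrite linearZ.
  by apply: eq_bigr => p _; rewrite linearZ.
- move=> p ps; apply/wP/in_span_mem; rewrite !mem_cat [_ \in map _ s']map_f ?orbT //.
move=> p ps; apply/wP/in_span_mem; rewrite !mem_cat [_ \in map _ s]map_f ?orbT //.
Qed.

End TorsionFree.

End DiscreteValuation.

(** * The discrete valuation ring of the affine line at the origin *)

Section LocalizedLine.
Variable k : fieldType.

Local Notation K := {fraction {poly k}}.

Local Notation "a %:F" := (tofrac a).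

Definition regular_at0 : {pred K} :=
  [pred y | `[< exists a b : {poly k}, b.[0] != 0 /\ y = a%:F / b%:F >]].

Lemma tofrac_neq0 (b : {poly k}) : b.[0] != 0 -> b%:F != 0.
Proof. by apply: contraNneq => /eqP; rewrite tofrac_eq0 => /eqP ->; rewrite horner0. Qed.

Fact regular_at0_closed : subring_closed regular_at0.
Proof.
split=> [|_ _ /asboolP[a [b [b0 ->]]] /asboolP[c [d [d0 ->]]]|
          _ _ /asboolP[a [b [b0 ->]]] /asboolP[c [d [d0 ->]]]]; apply/asboolP.
- by exists 1, 1; rewrite hornerE oner_eq0 !rmorph1 divr1.
- exists (a * d - c * b), (b * d); split; first by rewrite hornerM mulf_neq0.
  rewrite -[- (_ / _)]mulNr addf_div ?tofrac_neq0 //.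
  by rewrite rmorphB !rmorphM /= mulNr.
exists (a * c), (b * d); split; first by rewrite hornerM mulf_neq0.
by rewrite !rmorphM /= mulf_div.
Qed.

HB.instance Definition _ := GRing.isSubringClosed.Build K regular_at0
  regular_at0_closed.

(** [k[X]_(X)], as a subring of the field of rational functions. *)
Record local_line := LocalLine { line_val : K; line_valP : line_val \in regular_at0 }.
HB.instance Definition _ := [isSub for line_val].
HB.instance Definition _ := [Choice of local_line by <:].
HB.instance Definition _ := [SubChoice_isSubComNzRing of local_line by <:].

Definition line_unit : {pred local_line} :=
  [pred v | (val v != 0) && ((val v)^-1 \in regular_at0)].
Definition line_inv (v : local_line) : local_line := insubd v (val v)^-1.

Fact line_mulVr : {in line_unit, left_inverse 1 line_inv *%R}.
Proof.
move=> v /andP[v0 vi]; apply: val_inj; rewrite /= /line_inv.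
by rewrite [line_val _](val_insubd v) vi mulVf.
Qed.

Fact line_unitPl (v w : local_line) : w * v = 1 -> line_unit v.
Proof.
move=> /(congr1 val) /= wv; have v0 : val v != 0.
  by apply: contra_eq_neq wv => ->; rewrite mulr0 eq_sym oner_eq0.
rewrite /line_unit /= v0 /= -[_^-1]mul1r -wv mulfK //; exact: line_valP.
Qed.

Fact line_inv_out : {in [predC line_unit], line_inv =1 id}.
Proof.
move=> v nv; apply: val_inj; rewrite /line_inv [LHS]val_insubd; case: ifP => // vi.
have v0 : val v = 0.
  apply/eqP; apply: contraNT nv => v0; exact/andP.
by rewrite v0 invr0.
Qed.

HB.instance Definition _ := GRing.ComNzRing_hasMulInverse.Build local_line
  line_mulVr line_unitPl line_inv_out.

Fact line_integral : GRing.integral_domain_axiom local_line.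
Proof.
move=> v w /(congr1 val) /eqP; rewrite /= mulf_eq0.
by case/orP=> /eqP e; apply/orP; [left | right]; apply/eqP/val_inj.
Qed.

HB.instance Definition _ := GRing.ComUnitRing_isIntegral.Build local_line line_integral.

Lemma tofrac_regular (a : {poly k}) : a%:F \in regular_at0.
Proof. by apply/asboolP; exists a, 1; rewrite hornerE oner_eq0 rmorph1 divr1. Qed.

Definition line_of_poly (a : {poly k}) : local_line := LocalLine (tofrac_regular a).

Fact line_of_poly_zmod : zmod_morphism line_of_poly.
Proof. by move=> a b; apply: val_inj; rewrite /= rmorphB. Qed.
Fact line_of_poly_monoid : monoid_morphism line_of_poly.
Proof. by split=> [|a b]; apply: val_inj; rewrite /= ?rmorph1 ?rmorphM. Qed.
HB.instance Definition _ := GRing.isZmodMorphism.Build _ _ line_of_poly line_of_poly_zmod.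
HB.instance Definition _ := GRing.isMonoidMorphism.Build _ _ line_of_poly line_of_poly_monoid.

Definition line_alg : {rmorphism k -> local_line} := line_of_poly \o polyC.
Definition line_t : local_line := line_of_poly 'X.

Lemma line_of_poly_unit (b : {poly k}) : b.[0] != 0 -> line_of_poly b \is a GRing.unit.
Proof.
move=> b0; apply/andP; split; first exact: tofrac_neq0.
by apply/asboolP; exists 1, b; rewrite rmorph1 div1r.
Qed.

Lemma line_fracP (v : local_line) : exists a b : {poly k},
  b.[0] != 0 /\ v = line_of_poly a / line_of_poly b.
Proof.
case: v => v vP; case/asboolP: (vP) => a [b [b0 e]]; exists a, b; split=> //.
apply/(mulIr (line_of_poly_unit b0))/val_inj.
rewrite mulrVK ?line_of_poly_unit //= e divfK ?tofrac_neq0 //.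
Qed.

Lemma line_of_poly_inj : injective line_of_poly.
Proof. by move=> a b /(congr1 val) /eqP; rewrite /= tofrac_eq => /eqP. Qed.

Lemma line_t_neq0 : line_t != 0.
Proof. by rewrite -(rmorph0 line_of_poly) (inj_eq line_of_poly_inj) polyX_eq0. Qed.

Lemma line_t_nonunit v : line_t * v != 1.
Proof.
have [a [b [b0 ->]]] := line_fracP v; apply/eqP.
move/(congr1 (fun w => w * line_of_poly b)).
rewrite mulrA mulrVK ?line_of_poly_unit // mul1r -rmorphM => /line_of_poly_inj.
by move/(congr1 (fun p => p.[0])); rewrite !hornerE => /esym/eqP; apply/negP.
Qed.

(** Take out of the numerator the highest power of [X]; numerator and denominator
    then do not vanish at [0]. *)
Lemma line_decomp v : v != 0 -> exists n u, u \is a GRing.unit /\ v = line_t ^+ n * u.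
Proof.
have [a [b [b0 ->]]] := line_fracP v => v0.
have a0 : a != 0 by apply: contraNneq v0 => ->; rewrite rmorph0 mul0r.
have [n [q]] := multiplicity_XsubC a 0.
rewrite a0 /= => q0 ->; exists n, (line_of_poly q / line_of_poly b).
rewrite unitrM unitrV !line_of_poly_unit //; split=> //.
by rewrite rmorphM rmorphXn /= subr0 mulrAC mulrA mulrAC [RHS]mulrAC [RHS]mulrC mulrA.
Qed.

End LocalizedLine.

(** * Power series coefficients at the closed point *)

Section Taylor.
Variables (k : fieldType) (V : idomainType) (iV : {rmorphism k -> V}) (t : V).
Hypothesis t_neq0 : t != 0.
Hypothesis residue : residue_field_base iV t.

Lemma residueP v : exists c w, v = iV c + t * w.
Proof.
case: residue => g _ gK; exists (g (quotmod_pi (multiples t V^o) v)).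
have /eqP := gK (quotmod_pi (multiples t V^o) v).
rewrite -[_ == _]Quotient.idealrBE => /asboolP[w e].
by exists (- w); rewrite mulrN -[t * w]e subKr.
Qed.

Lemma residue_unique c w c' w' : iV c + t * w = iV c' + t * w' -> c = c'.
Proof.
move=> e; case: residue => g fK _; apply: (can_inj fK); apply: quotmod_pi_eq.
apply/asboolP; exists (w' - w).
rewrite -[RHS]/(t * (w' - w)) mulrBr; apply/eqP; rewrite subr_eq.
by rewrite addrAC [t * w' + _]addrC -e addrK.
Qed.

Definition residue_part v : k := sval (cid (residueP v)).
Definition shift_part v : V := sval (cid (svalP (cid (residueP v)))).

Lemma residue_partE v : v = iV (residue_part v) + t * shift_part v.
Proof. exact: (svalP (cid (svalP (cid (residueP v))))). Qed.

Lemma residue_part_unique c w :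
  residue_part (iV c + t * w) = c /\ shift_part (iV c + t * w) = w.
Proof.
have e := residue_partE (iV c + t * w).
have ec := residue_unique e; split; first exact/esym.
by apply/(mulfI t_neq0)/(addrI (iV c)); rewrite [RHS]e -ec.
Qed.

(** The coefficient of [t^n] in the expansion of [v] as a power series in [t]. *)
Fixpoint taylor (n : nat) (v : V) : k :=
  if n is m.+1 then taylor m (shift_part v) else residue_part v.

Lemma taylorP n a v w : taylor n (iV a * v + w) = a * taylor n v + taylor n w.
Proof.
have e v0 w0 : iV a * v0 + w0 = iV (a * residue_part v0 + residue_part w0) +
    t * (iV a * shift_part v0 + shift_part w0).
  rewrite {1}[v0]residue_partE {1}[w0]residue_partE rmorphD rmorphM; ring.
elim: n v w => [|n IH] v w /=; rewrite e;
  have [er es] := residue_part_unique (a * residue_part v + residue_part w)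
    (iV a * shift_part v + shift_part w); first exact: er.
by rewrite es.
Qed.

Lemma taylor_exp n m v : taylor (m + n) (t ^+ m * v) = taylor n v.
Proof.
elim: m => [|m IH]; first by rewrite expr0 mul1r.
rewrite addSn /= exprS -mulrA.
have := residue_part_unique 0 (t ^+ m * v); rewrite rmorph0 add0r => -[_ ->].
exact: IH.
Qed.

Lemma taylor_t v : taylor 0 (t * v) = 0.
Proof. by have := residue_part_unique 0 v; rewrite rmorph0 add0r => -[]. Qed.

Lemma taylor1 n : taylor n 1 = (n == 0%N)%:R.
Proof.
have := residue_part_unique 1 0; rewrite rmorph1 mulr0 addr0 => -[r1 s1].
case: n => [//|n] /=; rewrite s1; elim: n => [|n IH] /=.
  by have := residue_part_unique 0 0; rewrite rmorph0 mulr0 addr0 => -[].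
by have := residue_part_unique 0 0; rewrite rmorph0 mulr0 addr0 => -[_ ->].
Qed.

Local Notation Vt := (locring (powers t)).

Lemma powersP (s : denom (powers t)) : exists n, val s = t ^+ n.
Proof. by have /asboolP[n e] := valP s; exists n. Qed.

(** The coefficient of [t^0] in the Laurent expansion of an element of [V_t]. *)
Definition laurent0 (y : Vt) : k :=
  taylor (sval (cid (powersP (locden y)))) (locnum y : V).

Lemma laurent0E n v (s : denom (powers t)) : val s = t ^+ n ->
  laurent0 (locfrac (v : V^o) s) = taylor n v.
Proof.
move=> sn; have /locfrac_eq[u /asboolP[m um]] := locfrac_numden (locfrac (v : V^o) s).
rewrite /laurent0; set y := locfrac _ _; case: cid => d /= yd.
rewrite yd sn um => e.
have {}e : t ^+ n * (locnum y : V) = t ^+ d * v.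
  by apply: (mulfI (expf_neq0 m t_neq0)).
by rewrite -(taylor_exp d n) e addnC taylor_exp.
Qed.

Lemma laurent0P a (y z : Vt) :
  laurent0 (invert_alg iV t a * y + z) = a * laurent0 y + laurent0 z.
Proof.
have [v [s ->]] := locringP y; have [w [s' ->]] := locringP z.
have [n sn] := powersP s; have [m sm] := powersP s'.
rewrite [_ * _ in LHS]loc_mulE (loc_ringD (iV a * v) w).
rewrite (laurent0E (n := n + m)); last by rewrite /= mul1r sn sm exprD.
rewrite (laurent0E v sn) (laurent0E w sm) /= mul1r sn sm.
rewrite mulrCA taylorP -(taylor_exp n m) addnC taylor_exp.
by rewrite addnC taylor_exp.
Qed.

End Taylor.

(** * Degenerations from extensions with a nilpotent component *)

Lemma isomorphic_quotient (A0 A : comPzRingType) (i : {rmorphism A0 -> A})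
    (U : lmodType A) (S : submodClosed U) (N : lmodType A0)
    (h : {linear restr i U -> N}) :
  (forall u, h u = 0 <-> u \in S) -> (forall n, exists u, h u = n) ->
  isomorphic (restr i (quotmod S)) N.
Proof.
move=> hS hsurj.
have hpi (u v : U) : quotmod_pi S u = quotmod_pi S v -> h u = h v.
  move=> e; apply/subr0_eq; rewrite -linearB; apply/hS.
  move/eqP: e; rewrite -[_ == _]Quotient.idealrBE; exact.
pose f (y : restr i (quotmod S)) : N := h (repr (y : quotmod S)).
have fE (u : U) : f (quotmod_pi S u) = h u.
  by apply: hpi; rewrite /quotmod_pi reprK.
have fL : linear f.
  move=> a y z; have [u ->] := quotmod_piP y; have [v ->] := quotmod_piP z.
  have -> : a *: (quotmod_pi S u : restr i (quotmod S)) + quotmod_pi S v =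
      quotmod_pi S ((i a : A) *: u + v).
    by rewrite quotmod_piD -quotmod_scale_pi.
  by rewrite !fE -linearP.
exists (mk_linear fL); apply: inj_surj_bij => [y z|n].
  have [u ->] := quotmod_piP y; have [v ->] := quotmod_piP z.
  rewrite -![mk_linear _ _]/(f _) !fE => e; apply: quotmod_pi_eq; apply/hS.
  rewrite (_ : u - v = ((u : restr i U) - v)) // linearB.
  by apply/eqP; rewrite subr_eq0; apply/eqP.
by have [u <-] := hsurj n; exists (quotmod_pi S u); rewrite -[LHS]/(f _) fE.
Qed.

Section Degeneration.
Variables (k : fieldType) (R : comPzRingType) (iR : {rmorphism k -> R}).
Variables (V : idomainType) (iV : {rmorphism k -> V}) (t : V).
Hypothesis t_neq0 : t != 0.
Hypothesis residue : residue_field_base iV t.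

Local Notation Vt := (locring (powers t)).
Local Notation iVt := (invert_alg iV t).
Local Notation RV := (tensor_ring iR iV).
Local Notation RVt := (tensor_ring iR iVt).
Local Notation locV := (loc_in (powers t)).
Local Notation lau := (laurent0 residue).

Lemma t_power : t \in powers t.
Proof. by apply/asboolP; exists 1%N; rewrite expr1. Qed.

Definition inv_t : Vt := locfrac (1 : V^o) (exist _ t t_power).

Lemma inv_tK : inv_t * locV t = 1.
Proof.
rewrite [LHS]loc_mulE; apply/locfrac_eq; exists 1; first exact: rpred1.
by rewrite /= /GRing.scale /=; ring.
Qed.

Lemma lau_locV v : lau (locV v) = taylor residue 0 v.
Proof. by apply: laurent0E. Qed.

Lemma lau_t v : lau (locV (t * v)) = 0.
Proof. by rewrite lau_locV taylor_t. Qed.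

Lemma lau1 : lau 1 = 1.
Proof. by rewrite -[1 in LHS](rmorph1 locV) lau_locV taylor1. Qed.

Lemma inv_tX n : exists2 s : denom (powers t), val s = t ^+ n &
  inv_t ^+ n = locfrac (1 : V^o) s.
Proof.
elim: n => [|n [s sn e]]; first by exists (denom1 _).
exists (denomM (exist _ t t_power) s); first by rewrite /= sn exprS.
by rewrite exprS e [LHS]loc_mulE; apply: locfrac_congr; rewrite //= mulr1.
Qed.

Lemma lau_inv_t n : lau (inv_t ^+ n.+1) = 0.
Proof.
have [s sn ->] := inv_tX n.+1.
by rewrite (laurent0E t_neq0 residue 1 sn) taylor1.
Qed.

Lemma lauP a y z : lau (iVt a * y + z) = a * lau y + lau z.
Proof. exact: laurent0P. Qed.

Lemma lauD y z : lau (y + z) = lau y + lau z.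
Proof. by have := lauP 1 y z; rewrite rmorph1 !mul1r. Qed.

Lemma lau0 : lau 0 = 0.
Proof. by apply: (addrI (lau 0)); rewrite -lauD !addr0. Qed.

Lemma extend_compat c :
  tensor_inl iR iVt (iR c) = (tensor_inr iR iVt \o locV) (iV c).
Proof. exact: tensor_inlr. Qed.

(** The canonical map [R (x) V -> R (x) V_t]. *)
Definition extend_ring : {rmorphism RV -> RVt} := tensor_copair extend_compat.

Lemma extend_ringE r v : extend_ring (tens_ring iR iV r v) =
  tens_ring iR iVt r (locV v).
Proof. by rewrite [LHS]tensor_copair_tens tens_ringM mulr1 mul1r. Qed.

Section Extended.
Variable M : lmodType R.

Local Notation E := (extend_mod iR iV t M).
Local Notation pt := (@tens_mod k R Vt iR iVt M Vt^o).

Lemma ptD m m' y : pt (m + m') y = pt m y + pt m' y.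
Proof. exact: tens_modDl. Qed.

Lemma ptDr m y y' : pt m (y + y') = pt m y + pt m y'.
Proof. exact: tens_modDr. Qed.

Lemma ptZ c m y : pt (iR c *: m) y = pt m (iVt c * y).
Proof. exact: tens_modZ. Qed.

Lemma actE r y m y' : tens_ring iR iVt r y *: (pt m y' : E) = pt (r *: m) (y * y').
Proof. exact: tensor_act_tens. Qed.

Definition mulT (e : E) : E := tens_ring iR iVt 1 (locV t) *: e.

Lemma mulTE m y : mulT (pt m y) = pt m (locV t * y).
Proof. by rewrite /mulT actE scale1r. Qed.

Lemma mulTD e e' : mulT (e + e') = mulT e + mulT e'.
Proof. exact: scalerDr. Qed.

Lemma mulTZ c e : mulT (c *: e) = c *: mulT e.
Proof. by rewrite /mulT !scalerA mulrC. Qed.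

Lemma mulT_inj e : mulT e = 0 -> e = 0.
Proof.
move/(congr1 (fun e : E => tens_ring iR iVt 1 inv_t *: e)).
rewrite /mulT scalerA scaler0 tens_ringM mulr1 inv_tK.
by rewrite -[tens_ring _ _ 1 1]/(1 : RVt) scale1r.
Qed.

(** The coefficient of [t^0] of an element of [M (x) V_t]. *)
Definition coef0 (e : E) : M :=
  tensor_lift (fun (m : restr iR M) (y : restr iVt Vt^o) => iR (lau y) *: (m : M)) e.

Lemma coef0_balanced : balanced
  (fun (m : restr iR M) (y : restr iVt Vt^o) => iR (lau y) *: (m : M)).
Proof.
split=> [m m' y|m y y'|c m y]; first by rewrite scalerDr.
  by rewrite lauD rmorphD scalerDl.
rewrite -[c *: m]/(iR c *: (m : M)) -[c *: y]/(iVt c * (y : Vt)).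
by rewrite -[_ * _]addr0 lauP lau0 addr0 scalerA rmorphM mulrC.
Qed.

Lemma coef0E m y : coef0 (pt m y) = iR (lau y) *: m.
Proof. exact: (tensor_lift_tens coef0_balanced). Qed.

Lemma coef0D e e' : coef0 (e + e') = coef0 e + coef0 e'.
Proof. exact: (tensor_liftD coef0_balanced). Qed.

Lemma coef00 : coef0 0 = 0.
Proof. by apply: (addrI (coef0 0)); rewrite -coef0D !addr0. Qed.

Lemma E_ind (P : E -> Prop) : (forall m y, P (pt m y)) ->
  (forall e e', P e -> P e' -> P (e + e')) -> forall e, P e.
Proof. exact: tensor_mod_ind. Qed.

Lemma coef0Z r e : coef0 (tens_ring iR iVt r 1 *: e) = r *: coef0 e.
Proof.
elim/E_ind: e => [m y|e e' IH IH'].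
  by rewrite actE mul1r !coef0E !scalerA mulrC.
by rewrite scalerDr !coef0D IH IH' scalerDr.
Qed.

(** The image of [M (x) V] in [M (x) V_t]. *)
Definition integral (e : E) : Prop :=
  exists s : seq (M * V), e = \sum_(p <- s) (pt p.1 (locV p.2) : E).

Lemma integral_pt m v : integral (pt m (locV v)).
Proof. by exists [:: (m, v)]; rewrite big_seq1. Qed.

Lemma integral1 m : integral (pt m 1).
Proof. by rewrite -(rmorph1 locV); apply: integral_pt. Qed.

Lemma integral0 : integral 0.
Proof. by exists [::]; rewrite big_nil. Qed.

Lemma integralD e e' : integral e -> integral e' -> integral (e + e').
Proof. by case=> s -> [s' ->]; exists (s ++ s'); rewrite big_cat. Qed.

Lemma integral_ind (P : E -> Prop) : P 0 ->
  (forall m v, P (pt m (locV v))) -> (forall e e', P e -> P e' -> P (e + e')) ->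
  forall e, integral e -> P e.
Proof.
move=> P0 Pp PD e [s ->]; elim: s => [|p s IH]; first by rewrite big_nil.
by rewrite big_cons; apply: PD.
Qed.

Lemma integral_act r v e :
  integral e -> integral (tens_ring iR iVt r (locV v) *: e).
Proof.
elim/integral_ind => {e} [|m w|e e' IH IH'].
- by rewrite scaler0; apply: integral0.
- by rewrite actE -rmorphM; apply: integral_pt.
by rewrite scalerDr; apply: integralD.
Qed.

(** The expansion [v = v_0 + t v'] of scalars, extended to [M (x) V]. *)
Lemma integral_decomp e : integral e ->
  exists2 e', integral e' & e = pt (coef0 e) 1 + mulT e'.
Proof.
elim/integral_ind => {e} [|m v|e e' [f fi Ee] [f' fi' Ee']].
- exists 0; first exact: integral0.
  rewrite coef00 /mulT scaler0 addr0.
  by apply/(addrI (pt 0 1 : E)); rewrite -ptD !addr0.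
- exists (pt m (locV (shift_part residue v))); first exact: integral_pt.
  rewrite coef0E lau_locV ptZ mulr1 mulTE -rmorphM -ptDr.
  by rewrite -[iVt _]/(locV (iV _)) -rmorphD -residue_partE.
exists (f + f'); first exact: integralD.
by rewrite coef0D ptD mulTD addrACA -Ee -Ee'.
Qed.

Lemma coef0_mulT e : integral e -> coef0 (mulT e) = 0.
Proof.
elim/integral_ind => {e} [|m v|e e' IH IH'].
- by rewrite /mulT scaler0 coef00.
- by rewrite mulTE -rmorphM coef0E lau_t rmorph0 scale0r.
by rewrite mulTD coef0D IH IH' addr0.
Qed.

Lemma integral_mulT e : integral e -> integral (mulT e).
Proof. exact: integral_act. Qed.

End Extended.

(** The data of a short exact sequence [0 -> Z -> M (+) Z -> N -> 0] with maps
    [(theta, nu)] and [(m, z) |-> b m + c (theta z)], where [N] sits inside a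
    module [L]. That [c] is defined on all of [M] lets [rho] below be defined on
    all of [M (x) V_t]. *)
Variables (M Z L : lmodType R) (theta : {linear Z -> M}) (nu : {linear Z -> Z}).
Variables (b c : {linear M -> L}) (N : submodClosed L) (n : nat).
Hypothesis nu_nilp : forall z, iter n nu z = 0.
Hypothesis b_theta : forall z, b (theta z) + c (theta (nu z)) = 0.
Hypothesis bc_ker : forall m z, b m + c (theta z) = 0 ->
  exists w, m = theta w /\ z = nu w.
Hypothesis bc_im : forall l, l \in N <-> exists m z, l = b m + c (theta z).
Variables (gM : seq M) (gZ : seq Z).
Hypothesis gMP : forall m, in_span gM m.
Hypothesis gZP : forall z, in_span gZ z.

Local Notation E := (extend_mod iR iV t M).
Local Notation pt := (@tens_mod k R Vt iR iVt M Vt^o).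
Local Notation EV := (restr extend_ring E).

(** [theta (t - nu)^-1 z], expanded in powers of [t^-1 nu]. *)
Definition tau (z : Z) : E :=
  \sum_(0 <= i < n) (pt (theta (iter i nu z)) (inv_t ^+ i.+1) : E).

Lemma iter_nuP i r z z' :
  iter i nu (r *: z + z') = r *: iter i nu z + iter i nu z'.
Proof. by elim: i => //= i ->; rewrite linearP. Qed.

Lemma tauP r z z' : tau (r *: z + z') = tens_ring iR iVt r 1 *: tau z + tau z'.
Proof.
rewrite /tau scaler_sumr -big_split; apply: eq_bigr => i _ /=.
by rewrite actE mul1r iter_nuP linearP /= ptD.
Qed.

Lemma tauD z z' : tau (z + z') = tau z + tau z'.
Proof.
have := tauP 1 z z'; rewrite -[tens_ring _ _ 1 1]/(1 : RVt).
by rewrite !scale1r.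
Qed.

Lemma tau0 : tau 0 = 0.
Proof. by apply: (addrI (tau 0)); rewrite -tauD !addr0. Qed.

Lemma tauZ r z : tau (r *: z) = tens_ring iR iVt r 1 *: tau z.
Proof. by rewrite -[r *: z]addr0 tauP tau0 addr0. Qed.

Lemma pt0 y : pt 0 y = 0.
Proof. by apply: (addrI (pt 0 y)); rewrite -ptD !addr0. Qed.

(** The series of [t tau z] and [tau (nu z)] have the same terms, except for the
    first one of [t tau z] and the last one of [tau (nu z)], where [nu^n = 0]. *)
Lemma mulT_tau z : mulT (tau z) = (pt (theta z) 1 : E) + tau (nu z).
Proof.
rewrite /mulT /tau scaler_sumr.
case: n nu_nilp => [|d] nilp.
  rewrite !big_geq // addr0 -[z]/(iter 0 nu z) nilp linear0; exact/esym/pt0.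
rewrite big_nat_recl // [in RHS]big_nat_recr //= -iterSr nilp linear0.
rewrite [pt 0 _]pt0 addr0; congr (_ + _).
  by rewrite actE scale1r expr1 mulrC inv_tK.
apply: eq_bigr => i _; rewrite actE scale1r exprS mulrA.
by rewrite [locV t * _]mulrC inv_tK mul1r -iterSr.
Qed.

Lemma coef0_tau z : coef0 (tau z) = 0.
Proof.
rewrite /tau; elim/big_rec: _ => [|i e _ IH]; first exact: coef00.
by rewrite coef0D IH coef0E lau_inv_t rmorph0 scale0r addr0.
Qed.

(** The [R (x) V]-module generated by [M (x) V] and [(t - nu)^-1 Z]. It is the
    cokernel of [(theta, nu - t) : Z (x) V -> (M (+) Z) (x) V], seen inside its
    localization [M (x) V_t]. Since [t tau z = theta z (x) 1 + tau (nu z)] and [nu]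
    is nilpotent, [M (x) V + tau Z] is already stable under [V]. *)
Definition family_pred : {pred EV} :=
  [pred e | `[< exists y z, integral y /\ (e : E) = y + tau z >]].

Lemma family_integral y : integral y -> (y : EV) \in family_pred.
Proof. by move=> yi; apply/asboolP; exists y, 0; rewrite tau0 addr0. Qed.

Lemma family_tau z : (tau z : EV) \in family_pred.
Proof. by apply/asboolP; exists 0, z; rewrite add0r; split=> //; apply: integral0. Qed.

Lemma familyD (e e' : EV) : e \in family_pred -> e' \in family_pred ->
  e + e' \in family_pred.
Proof.
move=> /asboolP[y [z [yi ->]]] /asboolP[y' [z' [yi' ->]]]; apply/asboolP.
exists (y + y'), (z + z'); split; first exact: integralD.
by rewrite tauD addrACA.
Qed.

(** For [v = a + t w] one has [v tau z = tau (a z) + w (theta z (x) 1) + w tau (nu z)]: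
    induction on the order of nilpotency of [z]. *)
Lemma family_act_tau v z :
  (tens_ring iR iVt 1 (locV v) *: tau z : EV) \in family_pred.
Proof.
suff H d : iter d nu z = 0 ->
    (tens_ring iR iVt 1 (locV v) *: tau z : EV) \in family_pred by apply: (H n).
elim: d v z => [|d IH] v z.
  by move=> /= ->; rewrite tau0 scaler0 family_integral //; apply: integral0.
rewrite iterSr => /IH{}IH.
have -> : tens_ring iR iVt 1 (locV v) *: tau z =
    tau (iR (residue_part residue v) *: z) +
    (tens_ring iR iVt 1 (locV (shift_part residue v)) *: (pt (theta z) 1 : E) +
     tens_ring iR iVt 1 (locV (shift_part residue v)) *: tau (nu z)).
  rewrite -scalerDr -mulT_tau /mulT scalerA tens_ringM mulr1 tauZ -scalerDl.
  congr (_ *: _); rewrite -[iR _ in RHS]mulr1 tens_ringZ mulr1 -tens_ringDr.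
  congr tens_ring; rewrite {1}[v](residue_partE residue) rmorphD rmorphM /=.
  by rewrite [locV t * _]mulrC.
apply: familyD; first exact: family_tau.
by apply: familyD => //; apply/family_integral/integral_act/integral1.
Qed.

Fact family_closed : submod_closed family_pred.
Proof.
split=> [|c0 e e' eF e'F]; first by apply/family_integral/integral0.
apply: familyD => // {e' e'F}; elim/tensor_ring_ind: c0 => [r v|c1 c2 IH IH'].
  case/asboolP: eF => y [z [yi ->]].
  rewrite scalerDr; apply: familyD.
    rewrite -[_ *: _]/(extend_ring _ *: (y : E)) extend_ringE.
    exact/family_integral/integral_act.
  rewrite -[_ *: _]/(extend_ring _ *: (tau z : E)) extend_ringE.
  have -> : tens_ring iR iVt r (locV v) *: tau z =
      tens_ring iR iVt 1 (locV v) *: tau (r *: z).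
    by rewrite tauZ scalerA tens_ringM mulr1 mul1r.
  exact: family_act_tau.
by rewrite scalerDl; apply: familyD.
Qed.

Definition family : submodClosed EV := mk_submod family_closed.
Local Notation Q := (submod family).


Local Notation u := (tensor_uniformizer iR iV t).

Lemma EV_scaleE (r : RV) (e : EV) : r *: e = extend_ring r *: (e : E) :> E.
Proof. by []. Qed.

Lemma family_fg : finitely_generated Q.
Proof.
pose h : seq EV := [seq pt m 1 : E | m <- gM] ++ [seq tau z | z <- gZ].
have hS e : e \in h -> e \in family.
  rewrite mem_cat => /orP[/mapP[m _ ->]|/mapP[z _ ->]].
    exact/family_integral/integral1.
  exact: family_tau.
have [h' hh'] := submod_seq hS.
apply: (in_span_fg (g := h')) => -[e eF]; apply: in_span_submod_val.
rewrite hh' /=.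
case/asboolP: (eF) => y [z [yi ->]].
have hI := in_span_submod h.
apply: (is_submodD (u := y : EV) (v := tau z : EV)) => //.
  elim/integral_ind: {eF} y / yi => [|m v|y y' IH IH']; first by case: hI.
    have -> : (pt m (locV v) : EV) = tens_ring iR iV 1 v *: (pt m 1 : EV).
      by rewrite EV_scaleE extend_ringE actE scale1r mulr1.
    apply: is_submodZ => //.
    apply: (in_span_min (S := fun m => in_span h (pt m 1 : EV)) _ _ (gMP m)).
      split=> [|r m1 m2]; first by rewrite pt0; case: hI.
      have -> : (pt (r *: m1 + m2) 1 : EV) =
          tens_ring iR iV r 1 *: (pt m1 1 : EV) + (pt m2 1 : EV).
        by rewrite EV_scaleE extend_ringE actE rmorph1 mulr1 -ptD.
      by case: hI => _; apply.
    move=> m' m'g; apply: in_span_mem; rewrite mem_cat; apply/orP; left.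
    by apply/mapP; exists m'.
  exact: (is_submodD hI IH IH').
apply: (in_span_min (S := fun z => in_span h (tau z : EV)) _ _ (gZP z)).
  split=> [|r z1 z2]; first by rewrite tau0; case: hI.
  have -> : (tau (r *: z1 + z2) : EV) =
      tens_ring iR iV r 1 *: (tau z1 : EV) + (tau z2 : EV).
    by rewrite EV_scaleE extend_ringE rmorph1 tauP.
  by case: hI => _; apply.
move=> z' z'g; apply: in_span_mem; rewrite mem_cat; apply/orP; right.
by apply/mapP; exists z'.
Qed.

Lemma extend_u : extend_ring u = tens_ring iR iVt 1 (locV t).
Proof. exact: extend_ringE. Qed.

Lemma family_torsion_free (q : restr (tensor_inr iR iV) Q) : t *: q = 0 -> q = 0.
Proof.
move=> /(congr1 (fun q : Q => submod_val q)).
case: q => e eF; rewrite -[LHS]/(extend_ring u *: (e : E)) extend_u.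
by move/mulT_inj => e0; apply: val_inj.
Qed.

(** For [e = sum e_i t^i] this is [b e_0 + c e_(-1)], the residue at [t = 0] of
    [(t^-1 b + c) e]. On an integral [y] it is [b y_0] and on [tau z] it is
    [c (theta z)], so it maps the family onto [N]. *)
Definition rho (e : E) : L := b (coef0 e) + c (coef0 (mulT e)).

Lemma rhoD e e' : rho (e + e') = rho e + rho e'.
Proof. by rewrite /rho mulTD !coef0D !linearD addrACA. Qed.

Lemma rhoZ r e : rho (tens_ring iR iVt r 1 *: e) = r *: rho e.
Proof. by rewrite /rho mulTZ !coef0Z !linearZ scalerDr. Qed.

Lemma rhoE y z : integral y -> rho (y + tau z) = b (coef0 y) + c (theta z).
Proof.
move=> yi; rewrite /rho mulTD !coef0D coef0_tau addr0 (coef0_mulT yi) add0r.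
by rewrite mulT_tau coef0D coef0_tau addr0 coef0E lau1 rmorph1 scale1r.
Qed.

Lemma rho_mulT e : (e : EV) \in family_pred -> rho (mulT e) = 0.
Proof.
case/asboolP=> y [z [yi ->]].
rewrite mulTD mulT_tau addrA rhoE; last first.
  by apply: integralD; [apply: integral_mulT | apply: integral1].
by rewrite coef0D (coef0_mulT yi) add0r coef0E lau1 rmorph1 scale1r.
Qed.

(** If [rho (y + tau z) = 0], then [y_0 = theta w] and [z = nu w] for some [w], and
    [theta w (x) 1 + tau (nu w) = t tau w]. *)
Lemma rho_ker e : (e : EV) \in family_pred -> rho e = 0 ->
  exists2 e', (e' : EV) \in family_pred & e = mulT e'.
Proof.
case/asboolP=> y [z [yi ->]]; rewrite rhoE // => /bc_ker[w [yw ->]].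
have [y' yi' ->] := integral_decomp yi; exists (y' + tau w).
  by apply: familyD; [apply: family_integral | apply: family_tau].
by rewrite yw mulTD mulT_tau addrAC [RHS]addrC.
Qed.

Lemma rho_N (q : Q) : rho (submod_val q) \in N.
Proof.
case: q => e /= /asboolP[y [z [yi ->]]]; rewrite rhoE //.
by apply/bc_im; exists (coef0 y), z.
Qed.

Lemma family_special_fiber :
  isomorphic (restr (tensor_inl iR iV) (quotmod (multiples u Q))) (submod N).
Proof.
have fL : linear (fun q : restr (tensor_inl iR iV) Q => Submod (rho_N q)).
  move=> r q q'; apply: val_inj => /=.
  rewrite rhoD -[_ *: submod_val q]/(extend_ring (tens_ring iR iV r 1) *:
    (submod_val q : E)).
  by rewrite extend_ringE rmorph1 rhoZ.
apply: (isomorphic_quotient (h := mk_linear fL)) => [q|[l lN]].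
  split=> [/(congr1 val) /= q0|/asboolP[q' ->]]; last first.
    apply: val_inj; rewrite /= -[_ *: _]/(extend_ring u *: (submod_val q' : E)).
    by rewrite extend_u; apply: rho_mulT; apply: submodP.
  have [e' e'F qe'] := rho_ker (submodP q) q0.
  apply/asboolP; exists (Submod (S := family) e'F); apply: val_inj.
  by rewrite -[RHS]/(extend_ring u *: (e' : E)) extend_u.
have /bc_im[m [z e]] := lN.
have qF : ((pt m 1 : E) + tau z : EV) \in family.
  by apply: familyD; [apply/family_integral/integral1 | apply: family_tau].
exists (Submod qF); apply: val_inj => /=.
by rewrite rhoE ?coef0E ?lau1 ?rmorph1 ?scale1r //; apply: integral1.
Qed.

Lemma extend_denom (s : denom (powers u)) : exists r, r * extend_ring (val s) = 1.
Proof.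
have /asboolP[d ->] := valP s; exists (tens_ring iR iVt 1 inv_t ^+ d).
by rewrite rmorphXn extend_u -exprMn tens_ringM mulr1 inv_tK expr1n.
Qed.

Lemma extend_denom_inj (s : denom (powers u)) (e e' : E) :
  extend_ring (val s) *: e = extend_ring (val s) *: e' -> e = e'.
Proof.
have [r rs] := extend_denom s; move/(congr1 (fun e => r *: e)).
by rewrite !scalerA rs !scale1r.
Qed.

(** [t] is invertible on [M (x) V_t], so that the inclusion of the family extends
    to its localization. *)
Definition generic_map (y : locmod (powers u) Q) : E :=
  sval (cid (extend_denom (locden y))) *: (submod_val (locnum y) : E).

Lemma generic_mapP (q : Q) (s : denom (powers u)) :
  extend_ring (val s) *: generic_map (locfrac q s) = submod_val q.
Proof.
rewrite /generic_map; case: cid => r /= rs.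
have /locfrac_eq[w wS /(congr1 val) e] := locfrac_numden (locfrac q s).
have {}e : extend_ring (val s) *: (submod_val (locnum (locfrac q s)) : E) =
    extend_ring (val (locden (locfrac q s))) *: (submod_val q : E).
  exact: (extend_denom_inj (s := exist _ w wS)).
by rewrite scalerA mulrC -scalerA e scalerA rs scale1r.
Qed.

Lemma generic_mapE (q : Q) (s : denom (powers u)) (e : E) : extend_ring (val s) *: e = submod_val q ->
  generic_map (locfrac q s) = e.
Proof. by move=> es; apply: (extend_denom_inj (s := s)); rewrite generic_mapP. Qed.

(** [r] and its image in [(R (x) V)_t] are given by the same fraction [a / s]; so
    [generic_map] commutes with the action of [r]. *)
Lemma invert_tensor_frac (r : RVt) : exists (a : RV) s,
  invert_tensor iR iV t r = locfrac (a : RV^o) s /\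
  extend_ring (val s) * r = extend_ring a.
Proof.
elim/tensor_ring_ind: r => [r y|r r' [a [s [e es]]] [a' [s' [e' es']]]].
  have [v [s ->]] := locringP y.
  exists (tens_ring iR iV r v), (denom_map (@tensor_inr_powers k R V iR iV t) s).
  split.
    rewrite [LHS]tensor_copair_tens /= loc_mapE [LHS]loc_mulE.
    apply: locfrac_congr => /=; last by rewrite mul1r.
    by rewrite tens_ringM mulr1 mul1r.
  rewrite !extend_ringE tens_ringM mul1r [locV _ * _]loc_mulE; congr tens_ring.
  apply/locfrac_eq; exists 1; first exact: rpred1.
  by rewrite /= /GRing.scale /=; ring.
exists (val s' * a + val s * a'), (denomM s s'); split.
  by rewrite rmorphD e e' loc_ringD.
by rewrite rmorphD !rmorphM -es -es' /=; ring.
Qed.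

Lemma integral_extend (r : RV) (e : E) : integral e -> integral (extend_ring r *: e).
Proof.
move=> ei; elim/tensor_ring_ind: r => [r v|r r' IH IH'].
  by rewrite extend_ringE; apply: integral_act.
by rewrite rmorphD scalerDl; apply: integralD.
Qed.

Lemma integral_denom (e : E) :
  exists s : denom (powers u), integral (extend_ring (val s) *: e).
Proof.
elim/E_ind: e => [m y|e e' [s si] [s' si']].
  have [v [s ->]] := locringP y.
  exists (denom_map (@tensor_inr_powers k R V iR iV t) s).
  rewrite extend_ringE actE scale1r.
  have -> : locV (val s) * (locfrac (v : V^o) s : Vt) = locV v.
    rewrite [LHS]loc_mulE; apply/locfrac_eq; exists 1; first exact: rpred1.
    by rewrite /= /GRing.scale /=; ring.
  exact: integral_pt.
exists (denomM s s'); rewrite /= rmorphM scalerDr; apply: integralD.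
  by rewrite mulrC -scalerA; apply: integral_extend.
by rewrite -scalerA; apply: integral_extend.
Qed.

(** Surjective because a power of [t] maps any element of [M (x) V_t] into the
    image of [M (x) V], which the family contains. *)
Lemma family_generic_fiber : isomorphic (@invert_mod k R V iR iV t Q) E.
Proof.
have fL : linear (generic_map : @invert_mod k R V iR iV t Q -> E).
  move=> r y z; have [q [s ->]] := locfracP y; have [q' [s' ->]] := locfracP z.
  have [a [s0 [e es]]] := invert_tensor_frac r.
  have -> : r *: (locfrac q s : @invert_mod k R V iR iV t Q) = locfrac (a *: q) (denomM s0 s).
    rewrite -[LHS]/((invert_tensor iR iV t r : locring _) *: (locfrac q s : locmod _ Q)).
    by rewrite e; apply: loc_scaleE.
  rewrite [X in generic_map X]locfracD; apply: generic_mapE.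
  have -> : submod_val (val s' *: (a *: q) + val (denomM s0 s) *: q') =
      extend_ring (val s') *: (extend_ring a *: (submod_val q : E)) +
      extend_ring (val s0 * val s) *: (submod_val q' : E) by [].
  rewrite -(generic_mapP q s) -(generic_mapP q' s') -es /= !rmorphM.
  by rewrite scalerDr !scalerA; congr (_ *: _ + _ *: _); ring.
exists (mk_linear fL); apply: inj_surj_bij => [y z|e].
  have [q [s ->]] := locfracP y; have [q' [s' ->]] := locfracP z.
  rewrite -![mk_linear _ _]/(generic_map _) => e.
  apply/locfrac_eq; exists 1; first exact: rpred1.
  rewrite !scale1r; apply: val_inj.
  rewrite -[LHS]/(extend_ring (val s') *: (submod_val q : E)).
  rewrite -[RHS]/(extend_ring (val s) *: (submod_val q' : E)).
  rewrite -(generic_mapP q s) -(generic_mapP q' s') e.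
  by rewrite [LHS]scalerA [RHS]scalerA mulrC.
have [s si] := integral_denom e.
have qF := family_integral si.
exists (locfrac (Submod (S := family) qF) s).
exact: generic_mapE.
Qed.

End Degeneration.

(** The residue of [a / b] is [a(0) / b(0)]: the polynomial
    [b (a(0) / b(0)) - a] vanishes at [0], hence is a multiple of [X]. *)
Lemma line_residue (k : fieldType) : residue_field_base (line_alg k) (line_t k).
Proof.
apply: inj_surj_bij => [a b|y].
  move/eqP; rewrite -[_ == _]Quotient.idealrBE => /asboolP[v e].
  apply/eqP; rewrite -subr_eq0; apply: contraT => ab.
  have := line_t_nonunit (v * line_alg k (a - b)^-1).
  rewrite mulrA -[line_t k * v]e -[X in X * _](rmorphB (line_alg k)).
  by rewrite -rmorphM divff // rmorph1 eqxx.
have [v ->] := quotmod_piP y; have [a [b [b0 ->]]] := line_fracP v.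
exists (a.[0] / b.[0]); apply: quotmod_pi_eq; apply/asboolP.
pose p := b * (a.[0] / b.[0])%:P - a.
have /factor_theorem[q pq] : root p 0.
  by rewrite /root /p hornerD hornerN hornerM hornerC mulrC divfK // subrr.
exists (line_of_poly q / line_of_poly b).
have bu := line_of_poly_unit b0; apply: (mulrI bu).
rewrite mulrBr -[line_alg k _]/(line_of_poly _) -rmorphM.
rewrite [_ * (_ / _)]mulrC divrK // -rmorphB -/p pq subr0.
rewrite -[_ *: _]/(line_t k * (line_of_poly q / line_of_poly b)).
by rewrite rmorphM mulrCA [line_of_poly b * _]mulrC divrK // mulrC.
Qed.

(** The nilpotency of the component [nu : Z -> Z] is what makes [nu - t] invertible
    once [t] is, and so gives the family the generic fibre [M]. *)
Lemma degenerates_extension (k : fieldType) (R : comPzRingType)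
    (iR : {rmorphism k -> R}) (M Z L : lmodType R) (theta : {linear Z -> M})
    (nu : {linear Z -> Z}) (b c : {linear M -> L}) (N : submodClosed L) (n : nat) :
  (forall z, iter n nu z = 0) ->
  (forall z, b (theta z) + c (theta (nu z)) = 0) ->
  (forall m z, b m + c (theta z) = 0 -> exists w, m = theta w /\ z = nu w) ->
  (forall l, l \in N <-> exists m z, l = b m + c (theta z)) ->
  finitely_generated M -> finitely_generated Z ->
  degenerates iR M (submod N).
Proof.
suff [V [iV [t [t0 tu dec res]]]] : exists (V : idomainType)
    (iV : {rmorphism k -> V}) (t : V), [/\ t != 0, forall v, t * v != 1,
      forall v, v != 0 -> exists n u, u \is a GRing.unit /\ v = t ^+ n * u
      & residue_field_base iV t].
  move=> nilp b_theta bc_ker bc_im /fg_in_span[gM gMP] /fg_in_span[gZ gZP].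
  exists V, iV, t, (submod (family iR res theta nilp)); split.
  - by split; [apply: decomp_dvr | apply: res].
  - exact: (family_fg iR res theta nilp gMP gZP).
  - by apply: (torsion_free_flat t0 dec); apply: family_torsion_free.
  - exact: (family_special_fiber iR t0 res nilp b_theta bc_ker bc_im).
  exact: (family_generic_fiber iR res theta nilp).
exists (local_line k), (line_alg k), (line_t k); split.
- exact: line_t_neq0.
- exact: line_t_nonunit.
- exact: line_decomp.
exact: line_residue.
Qed.

Section Degenerates.
Variables (R : comPzRingType) (L : lmodType R) (alpha beta : {linear L -> L}).
Hypothesis im_alpha : forall l : L, (exists s, alpha s = l) <-> beta l = 0.
Hypothesis im_beta : forall l : L, (exists s, beta s = l) <-> alpha l = 0.
Variables (x : R) (x_reg : regular_element L x).
Hypothesis beta_Z : forall l : L, beta l \in Zmod x alpha.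
Variables (M : submodClosed L) (Z_M : {subset Zmod x alpha <= M}).

Local Notation Z := (submod (Zmod x alpha)).
Local Notation N := (submod (Nmod x alpha beta M)).
Local Notation eta := (etaZ im_alpha x_reg beta_Z).

Fact neg_eta_linear : linear (fun z : Z => - eta z).
Proof. by move=> a z z'; rewrite linearP opprD scalerN. Qed.

(** Since [x eta = beta] on [Z], [x^n (- eta)^n = +- beta^n]; cancel [x^n]. *)
Lemma neg_eta_nilpotent n : (forall l, iter n beta l = 0) ->
  forall z, iter n (mk_linear neg_eta_linear) z = 0.
Proof.
move=> nilp z; set nu := mk_linear _; apply: val_inj => /=.
have xn_reg l : x ^+ n *: l = 0 -> l = 0 :> L.
  elim: n {nilp} => [|n IH]; first by rewrite scale1r.
  by rewrite exprS -scalerA => /x_reg.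
apply: xn_reg.
have -> : x ^+ n *: submod_val (iter n nu z) =
    (-1) ^+ n *: iter n beta (submod_val z).
  elim: n {nilp} => [//|n IH].
  rewrite exprSr -scalerA.
  have -> : x *: submod_val (iter n.+1 nu z) = - beta (submod_val (iter n nu z)).
    by rewrite /= scalerN etaZP.
  by rewrite scalerN -(linear_scale beta) IH linear_scale exprS mulN1r scaleNr.
by rewrite nilp scaler0.
Qed.

(** [beta] and multiplication by [x] are defined on all of [M], so the sequence
    [0 -> Z -> M (+) Z -> N -> 0] has the form required above, with
    [nu = - eta]. *)
Lemma degenerates_M_N (k : fieldType) (iR : {rmorphism k -> R}) :
  finitely_generated Z -> finitely_generated (submod M) ->
  (exists n, forall l : L, iter n beta l = 0) ->
  degenerates iR (submod M) N.
Proof.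
move=> Zfg Mfg [n nilp].
pose theta : {linear Z -> submod M} :=
  @corestrict R Z L M \val (fun z => Z_M (submodP z)).
have cL : linear (fun m : submod M => x *: submod_val m).
  by move=> a m m' /=; rewrite scalerDr !scalerA mulrC.
pose b : {linear submod M -> L} := beta \o \val.
apply: (@degenerates_extension k R iR (submod M) Z L theta (mk_linear neg_eta_linear)
  b (mk_linear cL) _ n (neg_eta_nilpotent nilp)) => //.
- move=> z; rewrite -[LHS]/(beta (submod_val z) + x *: - submod_val (eta z)).
  by rewrite scalerN etaZP addrN.
- move=> m z /= e; have {}e : beta (submod_val m) = x *: submod_val (- z).
    by apply/eqP; rewrite /= scalerN -addr_eq0 e.
  exists (Submod (beta_multiple im_alpha im_beta x_reg e)).
  split; apply: val_inj => //=; apply: (x_inj x_reg).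
  by rewrite /= scalerN eta_funP /= e /= scalerN opprK.
move=> l; split=> [/asboolP[m [z [mM zZ ->]]]|[m [z ->]]].
  by exists (Submod mM), (Submod zZ).
by apply/asboolP; exists (submod_val m), (submod_val z); split=> //; apply: submodP.
Qed.

End Degenerates.



(** * Regular elements modulo a submodule *)

(** [mm] is to be the maximal ideal of a local ring. Quotients [U / W] are not
    formed: one works modulo [W], which is then easily enlarged. *)
Section RegularElements.
Variables (A : comPzRingType) (nA : noeth A).
Variables (mm : A -> Prop) (mmI : @is_submod A A^o mm).

Section AnnihilatorsModulo.
Variables (U : lmodType A) (W : U -> Prop) (WI : is_submod W).
Variables (gU : seq U) (gUP : forall u, in_span gU u).

Definition ann (u : U) (a : A) : Prop := W (a *: u).

Lemma ann_submod u : @is_submod A A^o (ann u).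
Proof.
split=> [|a b c bu cu]; first by rewrite /ann scale0r; case: WI.
by rewrite /ann scalerDl -scalerA; case: WI => _; apply.
Qed.

Definition max_ann (u : U) : Prop :=
  ~ W u /\ forall v, ~ W v -> (forall a, ann u a -> ann v a) ->
    forall a, ann v a -> ann u a.

Lemma max_ann_exists u : ~ W u ->
  exists2 v, max_ann v & forall a, ann u a -> ann v a.
Proof.
move=> uW; have [v [vW uv H]] := noeth_maximal nA (D := fun u => ~ W u) ann_submod uW.
by exists v.
Qed.

(** If [b u] is nonzero modulo [W], its annihilator is no larger than that of
    [u]. *)
Lemma max_ann_prime u a b : max_ann u -> ann u (a * b) -> ~ ann u b -> ann u a.
Proof.
move=> [uW umax] uab ub; apply: (umax (b *: u)) => //; last by rewrite /ann scalerA.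
by move=> c uc; rewrite /ann scalerA mulrC -scalerA; apply: is_submodZ.
Qed.

(** The product of one such [b] for each [v]: it stays outside [ann u], which is
    prime. *)
Lemma avoid_product (u : U) (l : seq U) : max_ann u ->
  (forall v, v \in l -> exists2 b, ann v b & ~ ann u b) ->
  exists2 b, ~ ann u b & forall v, v \in l -> ann v b.
Proof.
move=> umax; elim: l => [|v l IH] H.
  by exists 1 => //; rewrite /ann scale1r; case: umax.
have [|b bu bl] := IH; first by move=> w wl; apply: H; rewrite inE wl orbT.
have [|c vc uc] := H v; first by rewrite inE eqxx.
exists (c * b) => [ucb|w]; first exact/uc/(max_ann_prime umax ucb).
rewrite inE => /orP[/eqP ->|/bl wb].
  by rewrite /ann mulrC -scalerA; apply: is_submodZ.
by rewrite /ann -scalerA; apply: is_submodZ.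
Qed.

(** The elements with maximal annihilator generate a submodule which is finitely
    generated, hence generated by finitely many of them, [l]; if
    [u = sum c_i l_i] modulo [W], then the intersection of the [ann l_i] lies in
    the prime ideal [ann u]. *)
Lemma max_ann_finite : exists l : seq U, (forall v, v \in l -> max_ann v) /\
  forall u, max_ann u -> exists2 v, v \in l & forall a, ann v a -> ann u a.
Proof.
pose S u := exists2 l : seq U, (forall v, v \in l -> max_ann v) &
  exists2 w, W w & in_span l (u - w).
have SI : is_submod S.
  split=> [|a u v [l lm [w Ww uw]] [l' lm' [w' Ww' vw']]].
    by exists [::] => //; exists 0; [case: WI | rewrite /= subr0].
  exists (l ++ l') => [x|]; first by rewrite mem_cat => /orP[/lm|/lm'].
  exists (a *: w + w'); first by case: WI => _; apply.
  rewrite opprD addrACA -scalerBr; case: (in_span_submod (l ++ l')) => _; apply.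
    by apply: (@in_span_sub _ _ l) => // x xl; rewrite mem_cat xl.
  by apply: (@in_span_sub _ _ l') => // x xl; rewrite mem_cat xl orbT.
have [g [gS Sg]] := fg_subs nA SI (fun u _ => gUP u).
have [l lm Hl] : exists2 l : seq U, (forall v, v \in l -> max_ann v) &
    forall u, u \in g -> exists2 w, W w & in_span l (u - w).
  elim: g gS {Sg} => [|u g IH] gS; first by exists [::].
  have [|l lm Hl] := IH; first by move=> v vg; apply: gS; rewrite inE vg orbT.
  have [|l' lm' Hl'] := gS u; first by rewrite inE eqxx.
  exists (l ++ l') => [v|v]; first by rewrite mem_cat => /orP[/lm|/lm'].
  rewrite inE => /orP[/eqP ->|/Hl].
    case: Hl' => w Ww uw; exists w => //.
    by apply: (@in_span_sub _ _ l') => // x xl; rewrite mem_cat xl orbT.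
  case=> w Ww uw; exists w => //.
  by apply: (@in_span_sub _ _ l) => // x xl; rewrite mem_cat xl.
exists l; split=> // u umax; apply: contrapT => nol.
have [v vl|b ub lb] := avoid_product umax (l := l).
  apply: contrapT => nob; apply: nol; exists v => // a va.
  by apply: contrapT => nua; apply: nob; exists a.
have HlI : is_submod (fun u => exists2 w, W w & in_span l (u - w)).
  split=> [|a v v' [w Ww vw] [w' Ww' vw']].
    by exists 0; [case: WI | rewrite subr0; case: (in_span_submod l)].
  exists (a *: w + w'); first by case: WI => _; apply.
  by rewrite opprD addrACA -scalerBr; case: (in_span_submod l) => _; apply.
have [|w Ww uw] := in_span_min HlI Hl (Sg u _).
  exists [:: u] => [v|]; first by rewrite inE => /eqP ->.
  exists 0; first by case: WI.
  by rewrite subr0; apply: in_span_mem; rewrite inE.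
apply: ub; rewrite /ann -(subrK w u) scalerDr.
apply: is_submodD => //; last exact: is_submodZ.
apply: (in_span_min (S := fun v => W (b *: v)) _ lb uw).
split=> [|a v v' Wv Wv']; first by rewrite scaler0; case: WI.
by rewrite scalerDr scalerA mulrC -scalerA; case: WI => _; apply.
Qed.

(** Prime avoidance, for primes [ann v] that are equal or incomparable. If [a]
    avoids all of them but [ann u], correct it by an element that lies in all of
    them but [ann u]. *)
Lemma prime_avoidance (l : seq U) : (forall v, v \in l -> max_ann v) ->
  (forall v, v \in l -> exists2 a, mm a & ~ ann v a) ->
  exists2 a, mm a & forall v, v \in l -> ~ ann v a.
Proof.
elim: l => [|u l IH] lm lmm; first by exists 0 => //; case: mmI.
have [||a ma al] := IH.
- by move=> v vl; apply: lm; rewrite inE vl orbT.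
- by move=> v vl; apply: lmm; rewrite inE vl orbT.
have umax : max_ann u by apply: lm; rewrite inE eqxx.
have [ua|] := pselect (ann u a); last first.
  by move=> ua; exists a => // v; rewrite inE => /orP[/eqP ->|/al].
have [|b mb ub] := lmm u; first by rewrite inE eqxx.
have [v vl|c uc lc] := avoid_product umax (l := l).
  apply: contrapT => nob; apply: (al v vl).
  have [vW vmax] : max_ann v by apply: lm; rewrite inE vl orbT.
  apply: (vmax u) => //; first by case: umax.
  by move=> d vd; apply: contrapT => nud; apply: nob; exists d.
have ubc : ~ ann u (c * b) by move=> ucb; apply/uc/(max_ann_prime umax ucb).
exists (a + c * b) => [|v].
  by apply: (is_submodD (U := A^o)) => //; apply: (is_submodZ (U := A^o)).
rewrite inE => /orP[/eqP ->|vl] H.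
  by apply: ubc; have := is_submodB WI H ua; rewrite -scalerBl addrC addKr.
apply: (al v vl); have cbv : ann v (c * b).
  by rewrite /ann mulrC -scalerA; apply: is_submodZ => //; apply: lc.
by have := is_submodB WI H cbv; rewrite -scalerBl addrK.
Qed.

Definition no_socle : Prop := forall u, (forall a, mm a -> W (a *: u)) -> W u.

Definition regular_mod (a : A) : Prop := forall u, W (a *: u) -> W u.

Lemma regular_no_socle a : mm a -> regular_mod a -> no_socle.
Proof. by move=> ma ra u uW; apply/ra/uW. Qed.

(** Every zero divisor modulo [W] lies in one of finitely many maximal
    annihilators. None of them contains [mm], since that would make a nonzero
    element of the socle; choose an element of [mm] avoiding them all. *)
Lemma exists_regular : no_socle -> exists2 a, mm a & regular_mod a.
Proof.
move=> soc; have [l [lm Hl]] := max_ann_finite.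
have [v vl|a ma al] := prime_avoidance lm.
  have [vW _] := lm v vl.
  apply: contrapT => H; apply/vW/soc => a ma; apply: contrapT => nva.
  by apply: H; exists a.
exists a => // u ua; apply: contrapT => uW.
have [v vmax uv] := max_ann_exists uW.
have [v' v'l v'v] := Hl v vmax.
have [_ v'max] := lm v' v'l.
by apply: (al v' v'l); apply: (v'max v) => //; [case: vmax | apply: uv].
Qed.

End AnnihilatorsModulo.

(** * Depth does not depend on the regular sequence *)

Section WeaklyRegular.
Variable U : lmodType A.
Implicit Types (W : U -> Prop) (s : seq A).

Definition add_mult W (a : A) : U -> Prop := fun u => exists v, W (u - a *: v).

Fixpoint weakly_regular W s : Prop :=
  if s is a :: s' then regular_mod W a /\ weakly_regular (add_mult W a) s'
  else True.

Lemma add_mult_submod W a : is_submod W -> is_submod (add_mult W a).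
Proof.
move=> WI; split=> [|b u v [u' uu'] [v' vv']].
  by exists 0; rewrite scaler0 subr0; case: WI.
exists (b *: u' + v'); rewrite scalerDr opprD addrACA scalerA mulrC -scalerA.
by rewrite -scalerBr; case: WI => _; apply.
Qed.

Lemma add_multC W a b : add_mult (add_mult W a) b = add_mult (add_mult W b) a.
Proof.
by apply/funext => u; apply/propext; split=> -[v [v' H]]; exists v', v;
  rewrite addrAC.
Qed.

Definition depth_ge n W : Prop := exists s,
  [/\ size s = n, forall a, a \in s -> mm a & weakly_regular W s].

Lemma depth_geS n W : depth_ge n.+1 W <->
  exists a, [/\ mm a, regular_mod W a & depth_ge n (add_mult W a)].
Proof.
split=> [[[|a s] [//= [sn] sm [ra rs]]]|[a [ma ra [s [sn sm rs]]]]].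
  exists a; split=> //; first by apply: sm; rewrite inE eqxx.
  by exists s; split=> // b bs; apply: sm; rewrite inE bs orbT.
exists (a :: s); split=> //=; first by rewrite sn.
by move=> b; rewrite inE => /orP[/eqP ->|/sm].
Qed.

(** For [a] and [b] regular modulo [W], multiplication by [a] followed by
    division by [b] identifies the socles of [U / (W + b U)] and
    [U / (W + a U)]. *)
Lemma no_socle_exchange W a b : is_submod W -> mm a -> regular_mod W a ->
  regular_mod W b -> no_socle (add_mult W a) -> no_socle (add_mult W b).
Proof.
move=> WI ma ra rb soc u uW; have [u' uu'] := uW a ma.
have [u'' Wu''] : add_mult W a u'.
  apply: soc => c mc; have [v Wv] := uW c mc; exists v.
  apply: rb.
  have -> : b *: (c *: u' - a *: v) =
      a *: (c *: u - b *: v) - c *: (a *: u - b *: u').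
    rewrite !scalerBr !scalerA [a * c]mulrC opprB [RHS]addrC addrA subrK.
    by rewrite mulrC [a * b]mulrC.
  by apply: is_submodB => //; apply: is_submodZ.
exists u''; apply: ra.
have -> : a *: (u - b *: u'') = (a *: u - b *: u') + b *: (u' - a *: u'').
  by rewrite !scalerBr !scalerA addrA subrK mulrC.
by apply: is_submodD => //; apply: is_submodZ.
Qed.

End WeaklyRegular.

Section ChangeOfSequence.

Definition prod_mod (U1 U2 : lmodType A) (W1 : U1 -> Prop) (W2 : U2 -> Prop)
  (u : U1 * U2) : Prop := W1 u.1 /\ W2 u.2.

Lemma prod_mod_submod (U1 U2 : lmodType A) (W1 : U1 -> Prop) (W2 : U2 -> Prop) :
  is_submod W1 -> is_submod W2 -> is_submod (prod_mod W1 W2).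
Proof.
case=> z1 H1 [z2 H2]; split=> // a u v [Wu1 Wu2] [Wv1 Wv2].
by split; [apply: H1 | apply: H2].
Qed.

Lemma in_span_prod (U1 U2 : lmodType A) (g1 : seq U1) (g2 : seq U2) :
  (forall u, in_span g1 u) -> (forall u, in_span g2 u) ->
  exists g : seq (U1 * U2), forall u, in_span g u.
Proof.
move=> g1P g2P.
pose g : seq (U1 * U2) := [seq (u, 0) | u <- g1] ++ [seq (0, u) | u <- g2].
exists g => u; have -> : u = (u.1, 0) + (0, u.2).
  by case: u => u1 u2; congr (_, _); rewrite /= ?addr0 ?add0r.
apply: is_submodD (in_span_submod g) _ _.
  apply: (in_span_min (S := fun v => in_span g (v, 0)) _ _ (g1P u.1)).
    split=> [|a v w]; first by case: (in_span_submod g).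
    have -> : (a *: v + w, 0) = a *: (v, 0) + (w, 0) :> U1 * U2.
      by congr (_, _); rewrite /= scaler0 addr0.
    by case: (in_span_submod g) => _; apply.
  by move=> v vg; apply: in_span_mem; rewrite mem_cat map_f.
apply: (in_span_min (S := fun v => in_span g (0, v)) _ _ (g2P u.2)).
  split=> [|a v w]; first by case: (in_span_submod g).
  have -> : (0, a *: v + w) = a *: (0, v) + (0, w) :> U1 * U2.
    by congr (_, _); rewrite /= scaler0 addr0.
  by case: (in_span_submod g) => _; apply.
by move=> v vg; apply: in_span_mem; rewrite mem_cat map_f ?orbT.
Qed.

Lemma prod_mod_no_socle (U1 U2 : lmodType A) (W1 : U1 -> Prop) (W2 : U2 -> Prop) :
  no_socle W1 -> no_socle W2 -> no_socle (prod_mod W1 W2).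
Proof.
by move=> s1 s2 u uW; split; [apply: s1 | apply: s2] => a /uW[].
Qed.

Lemma prod_mod_regular (U1 U2 : lmodType A) (W1 : U1 -> Prop) (W2 : U2 -> Prop) a :
  is_submod W1 -> is_submod W2 -> regular_mod (prod_mod W1 W2) a ->
  regular_mod W1 a /\ regular_mod W2 a.
Proof.
move=> [z1 _] [z2 _] ra; split=> u uW.
  by have [] := ra (u, 0); first by split; rewrite //= scaler0.
by have [] := ra (0, u); first by split; rewrite //= scaler0.
Qed.

Variables (U : lmodType A) (gU : seq U) (gUP : forall u, in_span gU u).

Lemma depth_ge_no_socle n (W : U -> Prop) : depth_ge n.+1 W -> no_socle W.
Proof. by move/depth_geS=> [a [ma ra _]]; apply: regular_no_socle ra. Qed.

(** If [a u = c v] modulo [W], then [v] is a multiple of [a] since [c] is regular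
    modulo [W + a U]; cancel [a]. *)
Lemma regular_swap (W : U -> Prop) a c : is_submod W -> regular_mod W a ->
  regular_mod (add_mult W a) c -> regular_mod (add_mult W c) a.
Proof.
move=> WI ra rc u [v Wuv].
have [v' Wvv'] : add_mult W a v.
  apply: rc; exists u; rewrite -opprB; exact: is_submodN.
exists v'; apply: ra; rewrite scalerBr !scalerA mulrC -scalerA.
have -> : a *: u - c *: (a *: v') = (a *: u - c *: v) + c *: (v - a *: v').
  by rewrite scalerBr addrA subrK.
by apply: is_submodD => //; apply: is_submodZ.
Qed.

(** Depth does not depend on the choice of the first element of a regular
    sequence: compare [a] and [b] through an element [c] regular modulo [W],
    [W + a U] and [W + b U]. *)
Lemma depth_ge_add_mult n (W : U -> Prop) b : is_submod W ->
  depth_ge n.+1 W -> mm b -> regular_mod W b -> depth_ge n (add_mult W b).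
Proof.
elim: n W b => [|n IH] W b WI dW mb rb; first by exists [::].
have /depth_geS[a [ma ra da]] := dW.
have Wa := add_mult_submod a WI; have Wb := add_mult_submod b WI.
have soca := depth_ge_no_socle da.
have socb := no_socle_exchange WI ma ra rb soca.
have [c [mc rc rca rcb]] : exists c, [/\ mm c, regular_mod W c,
    regular_mod (add_mult W a) c & regular_mod (add_mult W b) c].
  have [g2 g2P] := in_span_prod gUP gUP; have [g3 g3P] := in_span_prod gUP g2P.
  have W2I := prod_mod_submod Wa Wb; have soc2 := prod_mod_no_socle soca socb.
  have [c mc rc] := exists_regular (prod_mod_submod WI W2I) g3P
    (prod_mod_no_socle (depth_ge_no_socle dW) soc2).
  have [rc1 rc2] := prod_mod_regular WI W2I rc.
  by have [rca rcb] := prod_mod_regular Wa Wb rc2; exists c.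
have dca : depth_ge n (add_mult (add_mult W a) c) by apply: IH.
have dc : depth_ge n.+1 (add_mult W c).
  apply/depth_geS; exists a; split=> //; first exact: regular_swap.
  by rewrite add_multC.
apply/depth_geS; exists c; split=> //; rewrite add_multC.
by apply: IH => //; [apply: add_mult_submod | apply: regular_swap].
Qed.

End ChangeOfSequence.

(** Elements regular on a direct sum are regular on both summands, and each
    summand, having depth at least [n], keeps depth at least [n - 1] modulo the
    first such element. *)
Lemma common_regular_sequence n (U1 U2 : lmodType A) (W1 : U1 -> Prop)
    (W2 : U2 -> Prop) (g1 : seq U1) (g2 : seq U2) :
  is_submod W1 -> is_submod W2 ->
  (forall u, in_span g1 u) -> (forall u, in_span g2 u) ->
  depth_ge n W1 -> depth_ge n W2 ->
  exists s, [/\ size s = n, forall a, a \in s -> mm a,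
    weakly_regular W1 s & weakly_regular W2 s].
Proof.
move=> W1I W2I g1P g2P; elim: n W1 W2 W1I W2I => [|n IH] W1 W2 W1I W2I d1 d2.
  by exists [::].
have [g gP] := in_span_prod g1P g2P.
have [a ma ra] := exists_regular (prod_mod_submod W1I W2I) gP
  (prod_mod_no_socle (depth_ge_no_socle d1) (depth_ge_no_socle d2)).
have [r1 r2] := prod_mod_regular W1I W2I ra.
have [||||s [sn sm rs1 rs2]] := IH (add_mult W1 a) (add_mult W2 a).
- exact: add_mult_submod.
- exact: add_mult_submod.
- exact: (depth_ge_add_mult g1P).
- exact: (depth_ge_add_mult g2P).
exists (a :: s); split=> //=; first by rewrite sn.
by move=> b; rewrite inE => /orP[/eqP ->|/sm].
Qed.

End RegularElements.

(** * Regular sequences and exact sequences *)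

Section ExactModulo.
Variables (A : comPzRingType).

(** Exactness of [0 -> U1/W1 -> U2/W2 -> U3/W3 -> 0]. *)
Definition exact_mod (U1 U2 U3 : lmodType A) (f : {linear U1 -> U2})
    (g : {linear U2 -> U3}) (W1 : U1 -> Prop) (W2 : U2 -> Prop)
    (W3 : U3 -> Prop) : Prop :=
  [/\ forall u, W2 (f u) <-> W1 u,
      forall v, W3 (g v) <-> exists u, W2 (v - f u) &
      forall w, exists v, g v = w].

Variables (U1 U2 U3 : lmodType A) (f : {linear U1 -> U2}) (g : {linear U2 -> U3}).
Lemma short_exact_mod : short_exact f g ->
  exact_mod f g (fun u => u = 0) (fun u => u = 0) (fun u => u = 0).
Proof.
case=> finj fg gsurj; split=> // [u|v].
  split=> [fu0|->]; last by rewrite linear0.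
  by apply: finj; rewrite fu0 linear0.
rewrite fg; split=> -[u e]; exists u; first by rewrite e subrr.
by apply/esym/subr0_eq.
Qed.

(** The snake lemma for multiplication by [a], whose kernel on [U3 / W3] is
    zero. *)
Lemma exact_mod_add_mult W1 W2 W3 a : is_submod W2 -> is_submod W3 ->
  exact_mod f g W1 W2 W3 -> regular_mod W3 a ->
  exact_mod f g (add_mult W1 a) (add_mult W2 a) (add_mult W3 a).
Proof.
move=> W2I W3I [fW gW gsurj] ra; split=> // [u|v].
  split=> [[v uv]|[u' uu']].
    have gv : W3 (g v).
      apply: ra; rewrite -linearZ -[g _](subKr (g (f u))) -linearB.
      apply: is_submodB => //; apply/gW; first by exists u; rewrite subrr; case: W2I.
      by exists 0; rewrite linear0 subr0.
    have [u' vu'] := (gW v).1 gv; exists u'; apply/fW.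
    rewrite linearB linearZ /=.
    have -> : f u - a *: f u' = (f u - a *: v) + a *: (v - f u').
      by rewrite scalerBr addrA subrK.
    by apply: is_submodD => //; apply: is_submodZ.
  by exists (f u'); rewrite -linearZ -linearB; apply/fW.
split=> [[w]|[u [v' vv']]].
  have [v' <-] := gsurj w; rewrite -linearZ -linearB => /gW[u uv].
  by exists u, v'; rewrite addrAC.
exists (g v'); rewrite -linearZ -linearB; apply/gW; exists u.
by rewrite addrAC.
Qed.

Lemma regular_middle W1 W2 W3 a : is_submod W2 -> exact_mod f g W1 W2 W3 ->
  regular_mod W1 a -> regular_mod W3 a -> regular_mod W2 a.
Proof.
move=> W2I [fW gW _] r1 r3 v av.
have gv : W3 (g v).
  by apply: r3; rewrite -linearZ; apply/gW; exists 0; rewrite linear0 subr0.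
have [u uv] := (gW v).1 gv; rewrite -(subrK (f u) v); apply: is_submodD => //.
apply/fW/r1/fW; rewrite linearZ /=.
have -> : a *: f u = a *: v - a *: (v - f u).
  by rewrite scalerBr opprB addrC subrK.
by apply: is_submodB => //; apply: is_submodZ.
Qed.

Lemma regular_left W1 W2 W3 a : exact_mod f g W1 W2 W3 ->
  regular_mod W2 a -> regular_mod W1 a.
Proof. by move=> [fW _ _] r2 u au; apply/fW/r2; rewrite -linearZ; apply/fW. Qed.

Lemma weakly_regular_middle W1 W2 W3 s :
  is_submod W1 -> is_submod W2 -> is_submod W3 -> exact_mod f g W1 W2 W3 ->
  weakly_regular W1 s -> weakly_regular W3 s -> weakly_regular W2 s.
Proof.
elim: s W1 W2 W3 => //= a s IH W1 W2 W3 I1 I2 I3 E [r1 s1] [r3 s3].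
split; first exact: (regular_middle I2 E).
apply: (IH (add_mult W1 a) _ (add_mult W3 a)); try exact: add_mult_submod.
- exact: exact_mod_add_mult.
- exact: s1.
exact: s3.
Qed.

Lemma weakly_regular_left W1 W2 W3 s :
  is_submod W1 -> is_submod W2 -> is_submod W3 -> exact_mod f g W1 W2 W3 ->
  weakly_regular W2 s -> weakly_regular W3 s -> weakly_regular W1 s.
Proof.
elim: s W1 W2 W3 => //= a s IH W1 W2 W3 I1 I2 I3 E [r2 s2] [r3 s3].
split; first exact: (regular_left E).
apply: (IH _ (add_mult W2 a) (add_mult W3 a)); try exact: add_mult_submod.
- exact: exact_mod_add_mult.
- exact: s2.
exact: s3.
Qed.

End ExactModulo.

(** Two extensions [0 -> K -> L -> J -> 0] and [0 -> J -> L -> K -> 0] make [K]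
    and [J] syzygies of each other: an element regular on [L] is regular on the
    submodules [K] and [J], which in turn keeps both sequences exact modulo this
    element. *)
Lemma weakly_regular_periodic (A : comPzRingType) (K L J : lmodType A)
    (f : {linear K -> L}) (g : {linear L -> J})
    (f' : {linear J -> L}) (g' : {linear L -> K})
    (WK : K -> Prop) (WL : L -> Prop) (WJ : J -> Prop) s :
  is_submod WK -> is_submod WL -> is_submod WJ ->
  exact_mod f g WK WL WJ -> exact_mod f' g' WJ WL WK ->
  weakly_regular WL s -> weakly_regular WK s /\ weakly_regular WJ s.
Proof.
elim: s WK WL WJ => //= a s IH WK WL WJ IK IL IJ E E' [rL sL].
have rK := regular_left E rL; have rJ := regular_left E' rL.
have [||||||sK sJ] := IH (add_mult WK a) (add_mult WL a) (add_mult WJ a);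
  by [apply: add_mult_submod | apply: exact_mod_add_mult | ].
Qed.

(** * Depth over a local ring *)

Section Depth.
Variable A : comPzRingType.

Definition nonunit (a : A) : Prop := ~ exists b, a * b = 1.

Variable U : lmodType A.

Lemma zero_submod : is_submod (fun u : U => u = 0).
Proof. by split=> // a u v -> ->; rewrite scaler0 addr0. Qed.

Lemma in_ideal_mul0 (s : seq A) : in_ideal_mul (M := U) s 0 = (fun u => u = 0).
Proof.
apply/funext => u; apply/propext; split=> [[f ->]|->]; first by rewrite big_ord0.
by exists (fun=> 0); rewrite big_ord0.
Qed.

Lemma in_ideal_mulS (s : seq A) i :
  in_ideal_mul (M := U) s i.+1 = add_mult (in_ideal_mul (M := U) s i) s`_i.
Proof.
apply/funext => u; apply/propext; split=> [[f ->]|[v [f e]]].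
  by exists (f i), f; rewrite big_ord_recr /= addrK.
exists (fun j => if j == i then v else f j); rewrite big_ord_recr /= eqxx.
rewrite -(subrK (s`_i *: v) u) e; congr (_ + _); apply: eq_bigr => j _.
by rewrite ltn_eqF.
Qed.

Lemma weakly_regular_drop (s : seq A) k : (k <= size s)%N ->
  weakly_regular (in_ideal_mul (M := U) s k) (drop k s) <->
  forall i (u : U), (k <= i < size s)%N ->
    in_ideal_mul s i (s`_i *: u) -> in_ideal_mul s i u.
Proof.
move=> ks; rewrite -(subKn ks); move: (size s - k)%N (leq_subr k (size s)).
elim=> [_|d IH ds].
  by rewrite subn0 drop_size; split=> // _ i u; rewrite leqNgt andNb.
have ds' : (size s - d.+1 < size s)%N by rewrite ltn_subrL /= (leq_trans _ ds).
rewrite (drop_nth 0 ds') /= -in_ideal_mulS subnSK //.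
split=> [[r /(IH (ltnW ds)) H] i u /andP[]|H].
  rewrite leq_eqVlt subnSK // => /orP[/eqP <- _|ii is_]; first exact: r.
  by apply: H; rewrite ii.
split=> [u|]; first by apply: H; rewrite leqnn.
apply/(IH (ltnW ds)) => i u /andP[ii is_]; apply: H.
by rewrite is_ andbT (leq_trans _ ii) // leq_sub2l.
Qed.

Lemma weakly_regularP (s : seq A) :
  weakly_regular (fun u : U => u = 0) s <->
  forall i (u : U), (i < size s)%N ->
    in_ideal_mul s i (s`_i *: u) -> in_ideal_mul s i u.
Proof.
have := weakly_regular_drop (leq0n (size s)).
by rewrite drop0 in_ideal_mul0.
Qed.

Hypothesis nonunit_submod : @is_submod A A^o nonunit.

(** Nakayama's lemma: a generator [v] of [U = (s) U] is a combination of the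
    others, since [v = c v + ...] with [1 - c] invertible. *)
Lemma nakayama (s : seq A) (g : seq U) : (forall a, a \in s -> nonunit a) ->
  (forall u, in_span g u) -> (forall u : U, in_ideal_mul s (size s) u) ->
  forall u : U, u = 0.
Proof.
move=> sN gP sU; elim: g gP => [//|v g IH] gP; apply: IH.
have [f fv] := sU v.
have : exists2 c, nonunit c & in_span g (v - c *: v).
  rewrite {1}fv.
  apply: (is_submod_sum (S := fun w => exists2 c, nonunit c & in_span g (w - c *: v))).
    split=> [|a w w' [c cN wc] [c' cN' wc']].
      exists 0; first by case: nonunit_submod.
      by rewrite scale0r subr0; case: (in_span_submod g).
    exists (a * c + c'); first by case: nonunit_submod => _; apply.
    rewrite scalerDl opprD addrACA -scalerA -scalerBr.
    by case: (in_span_submod g) => _; apply.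
  move=> j; have [c fc] := gP (f j); exists (s`_j * c).
    rewrite mulrC; apply: (is_submodZ (U := A^o) (S := @nonunit)) => //.
    by apply: sN; rewrite mem_nth.
  by rewrite -scalerA -scalerBr; apply: is_submodZ fc; apply: in_span_submod.
case=> c cN vc; have [b bP] : exists b, (1 - c) * b = 1.
  apply: contrapT => nb; have : nonunit 1.
    by rewrite -(subrK c 1); apply: (is_submodD (U := A^o) (S := @nonunit)).
  by apply; exists 1; rewrite mulr1.
have vg : in_span g v.
  rewrite -[v]scale1r -bP mulrC -scalerA scalerBl scale1r.
  by apply: is_submodZ => //; apply: in_span_submod.
move=> u; apply: in_span_min (gP u); first exact: in_span_submod.
by move=> w; rewrite inE => /orP[/eqP ->|/in_span_mem].
Qed.

(** On the zero module every sequence is weakly regular, for instance the constant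
    sequence [0]. *)
Lemma depth_ge_of_le_depth n :
  le_depth n U -> depth_ge nonunit n (fun u : U => u = 0).
Proof.
case=> [U0|[s [sn sN [sr _]]]]; last first.
  by exists s; split=> //; apply/weakly_regularP.
exists (nseq n 0); rewrite size_nseq; split=> //.
  by move=> a /nseqP[-> _]; case: nonunit_submod.
apply/weakly_regularP => i u _ _; exists (fun=> 0).
by rewrite (U0 u) big1 // => j _; rewrite scaler0.
Qed.

Lemma le_depth_of_weakly_regular n (g : seq U) (s : seq A) :
  (forall u, in_span g u) -> size s = n -> (forall a, a \in s -> nonunit a) ->
  weakly_regular (fun u : U => u = 0) s -> le_depth n U.
Proof.
move=> gP sn sN /weakly_regularP sr.
have [U0|nU0] := pselect (forall u : U, u = 0); first by left.
right; exists s; split=> //; split=> //; apply: contrapT => H; apply: nU0.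
by apply: (nakayama sN gP) => u; apply: contrapT => nu; apply: H; exists u.
Qed.

End Depth.

(** * Localization *)

Section Localization.
Variables (A : comPzRingType) (S : mulrClosed A).

Lemma locfracZ (M : lmodType A) (a : A) s (m : M) s' :
  (locfrac (a : A^o) s : locring S) *: locfrac m s' =
  locfrac (a *: m) (denomM s s').
Proof. exact: loc_scaleE. Qed.

Lemma locfrac0 (M : lmodType A) (s : denom S) : locfrac (0 : M) s = 0.
Proof.
apply/locfrac_eq; exists 1; first exact: rpred1.
by rewrite !scaler0.
Qed.

Lemma locfrac1Z (M : lmodType A) (m : M) (s : denom S) :
  locfrac m s =
  (locfrac (1 : A^o) s : locring S) *: locfrac m (denom1 S).
Proof. by rewrite locfracZ scale1r; apply: locfrac_congr => //=; rewrite mulr1. Qed.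

Lemma locfrac1P (M : lmodType A) (a : A) (m n : M) :
  locfrac (a *: m + n) (denom1 S) =
  (locfrac (a : A^o) (denom1 S) : locring S) *: locfrac m (denom1 S)
  + locfrac n (denom1 S).
Proof.
rewrite locfracZ locfracD; apply: locfrac_congr => /=; last by rewrite !mulr1.
by rewrite mulr1 !scale1r.
Qed.

Section Functor.
Variables (M N : lmodType A) (f : {linear M -> N}).

Definition locmod_map_fun (y : locmod S M) : locmod S N :=
  locfrac (f (locnum y)) (locden y).

Lemma locmod_map_funE m s : locmod_map_fun (locfrac m s) = locfrac (f m) s.
Proof.
rewrite /locmod_map_fun; have /locfrac_eq[u uS e] := locfrac_numden (locfrac m s).
apply/locfrac_eq; exists u; first by [].
by move: (congr1 f e); rewrite !(linear_scale f).
Qed.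

Lemma locmod_map_fun_linear : linear locmod_map_fun.
Proof.
move=> c y z; have [a [s ->]] := locringP c.
have [m [s' ->]] := locfracP y; have [n [s'' ->]] := locfracP z.
rewrite locfracZ locfracD !locmod_map_funE locfracZ locfracD.
by rewrite linearD !(linear_scale f).
Qed.

Definition locmod_map : {linear locmod S M -> locmod S N} :=
  mk_linear locmod_map_fun_linear.

End Functor.

Lemma locmod_mapE (M N : lmodType A) (f : {linear M -> N}) m s :
  locmod_map f (locfrac m s) = locfrac (f m) s.
Proof. exact: locmod_map_funE. Qed.

Lemma short_exact_locmod (M' M M'' : lmodType A) (f : {linear M' -> M})
    (g : {linear M -> M''}) :
  short_exact f g -> short_exact (locmod_map f) (locmod_map g).
Proof.
case=> finj fg gsurj; split=> [y z|y|z].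
- have [m [s ->]] := locfracP y; have [n [s' ->]] := locfracP z.
  rewrite !locmod_mapE => /locfrac_eq[u uS e]; apply/locfrac_eq; exists u => //.
  by apply: finj; rewrite !(linear_scale f).
- have [m [s ->]] := locfracP y; rewrite locmod_mapE; split; last first.
    case=> z; have [n [s' ->]] := locfracP z.
    rewrite locmod_mapE -(locmod_mapE g) => <-; rewrite locmod_mapE.
    by rewrite ((fg _).2 (ex_intro _ n erefl)) locfrac0.
  rewrite -(locfrac0 M'' s) => /locfrac_eq[u uS e].
  have /fg[n fn] : g ((u * val s) *: m) = 0.
    by rewrite (linear_scale g) -scalerA e !scaler0.
  exists (locfrac n (denomM (denomM (exist _ u uS) s) s)); rewrite locmod_mapE fn.
  apply/locfrac_eq; exists 1; rewrite ?rpred1 // !scalerA.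
  by congr (_ *: _); rewrite /= ; ring.
have [n [s ->]] := locfracP z; have [m <-] := gsurj n.
by exists (locfrac m s); rewrite locmod_mapE.
Qed.

Lemma in_span_locmod (M : lmodType A) (g : seq M) : (forall m, in_span g m) ->
  exists h : seq (locmod S M), forall y, in_span h y.
Proof.
move=> gP; exists [seq locfrac m (denom1 S) | m <- g] => y; set h := map _ _.
have [m [s ->]] := locfracP y; rewrite locfrac1Z.
apply: is_submodZ; first exact: in_span_submod.
apply: (in_span_min (S := fun m => in_span h (locfrac m (denom1 S))) _ _ (gP m)).
  split=> [|a m1 m2]; first by rewrite locfrac0; case: (in_span_submod h).
  by rewrite locfrac1P; case: (in_span_submod h) => _; apply.
by move=> u ug; apply/in_span_mem/map_f.
Qed.

(** An ideal is generated by the numerators of its elements. *)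
Lemma noeth_locring : noeth A -> noeth (locring S).
Proof.
move=> nA I II.
pose Ic (a : A) := I (locfrac (a : A^o) (denom1 S) : locring S).
have IcI : @is_submod A A^o Ic.
  split=> [|a b c bI cI]; first by rewrite /Ic locfrac0; case: II.
  have := locfrac1P a (b : A^o) c; rewrite /Ic => ->.
  by case: II => _; apply.
have [g [gI Ig]] := nA _ IcI.
exists [seq locfrac (a : A^o) (denom1 S) : locring S | a <- g].
set h := map _ _; split=> [_ /mapP[a /gI aI ->] //|y yI].
have [a [s e]] := locringP y; rewrite e in yI *.
have e1 := locfrac1Z (a : A^o) s; rewrite e1.
apply: is_submodZ; first exact: in_span_submod.
have /Ig ag : Ic a.
  have := is_submodZ (locfrac (val s : A^o) (denom1 S) : locring S) II yI.
  rewrite /Ic; congr (I _); rewrite -[LHS]/(loc_mul _ _) loc_mulE.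
  apply/locfrac_eq; exists 1; first exact: rpred1.
  by rewrite /= /GRing.scale /=; ring.
pose T (b : A^o) : Prop :=
  @in_span _ (locring S)^o h (locfrac (b : A^o) (denom1 S)).
have TI : is_submod T.
  split=> [|b m1 m2]; first by rewrite /T locfrac0; exact: (in_span_submod (U := (locring S)^o) h).1.
  rewrite /T locfrac1P.
  exact: (in_span_submod (U := (locring S)^o) h).2.
by apply: (in_span_min TI) ag => u ug; apply/in_span_mem/map_f.
Qed.

End Localization.

Section LocalAtPrime.
Variables (A : comPzRingType) (p : primeIdeal A).

Local Notation Ap := (locring (prime_compl p)).

Lemma nonunit_locfrac (a : A) s :
  nonunit (locfrac (a : A^o) s : Ap) <-> (a : A^o) \in p.
Proof.
split=> [nu|ap [y]].
  apply: contrapT => nap; apply: nu.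
  have aS : a \in prime_compl p by apply/negP.
  exists (locfrac (val s : A^o) (exist _ a aS)).
  rewrite -[LHS]/(loc_mul _ _) loc_mulE; apply/locfrac_eq.
  exists 1; first exact: rpred1.
  by rewrite /= /GRing.scale /=; ring.
have [b [s' ->]] := locringP y.
rewrite -[LHS]/(loc_mul _ _) loc_mulE => /locfrac_eq[u uS].
rewrite /= /GRing.scale /= => e.
have : u * (val s * val s' * 1) \in prime_compl p.
  by rewrite mulr1 !rpredM // (valP s, valP s').
rewrite inE -e => /negP; apply.
rewrite (_ : u * _ = (u * b) *: (a : A^o)); last by rewrite /GRing.scale /=; ring.
exact: rpredZ.
Qed.

Lemma nonunit_submod_locring : @is_submod Ap Ap^o (@nonunit Ap).
Proof.
split=> [|y z w].
  suff: nonunit (locfrac (0 : A^o) (denom1 (prime_compl p)) : Ap).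
    by rewrite locfrac0.
  by apply/nonunit_locfrac; apply: rpred0.
have [a [s ->]] := locringP y; have [b [s' ->]] := locringP z.
have [c [s'' ->]] := locringP w.
move=> /nonunit_locfrac bp /nonunit_locfrac cp.
have e : (locfrac (a : A^o) s : Ap) *: (locfrac (b : A^o) s' : Ap^o)
  = locfrac (a * b : A^o) (denomM s s') by exact: loc_mulE.
rewrite e; have e' := loc_ringD (a * b) c (denomM s s') s''; rewrite e'.
apply/nonunit_locfrac; apply: (rpredD (S := p)).
  by rewrite mulrA; apply: (rpredZ (s := p)).
exact: (rpredZ (s := p)).
Qed.

End LocalAtPrime.

(** * Cohen-Macaulay modules *)

Lemma short_exact_pair (A : pzRingType) (U V : lmodType A) :
  exists (f : {linear U -> (U * V)%type}) (g : {linear (U * V)%type -> V}),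
    short_exact f g.
Proof.
have fL : linear (fun u : U => (u, 0 : V)).
  by move=> a u v; congr (_, _); rewrite /= scaler0 addr0.
exists (mk_linear fL), snd; split=> [u v []|[u v]|v] //=; last by exists (0, v).
by split=> [->|[u' [_ <-]] //]; exists u.
Qed.

Section LocallyRegular.
Variables (A : comPzRingType) (S : mulrClosed A).

Definition loc_regular (U : lmodType A) (s : seq (locring S)) : Prop :=
  weakly_regular (fun u : locmod S U => u = 0) s.

Lemma loc_regular_middle (U1 U2 U3 : lmodType A) s :
  (exists (f : {linear U1 -> U2}) (g : {linear U2 -> U3}), short_exact f g) ->
  loc_regular U1 s -> loc_regular U3 s -> loc_regular U2 s.
Proof.
case=> f [g fg]; apply: weakly_regular_middle; try exact: zero_submod.
exact: short_exact_mod (short_exact_locmod S fg).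
Qed.

Lemma loc_regular_left (U1 U2 U3 : lmodType A) s :
  (exists (f : {linear U1 -> U2}) (g : {linear U2 -> U3}), short_exact f g) ->
  loc_regular U2 s -> loc_regular U3 s -> loc_regular U1 s.
Proof.
case=> f [g fg]; apply: weakly_regular_left; try exact: zero_submod.
exact: short_exact_mod (short_exact_locmod S fg).
Qed.

Lemma loc_regular_periodic (K L J : lmodType A) s :
  (exists (f : {linear K -> L}) (g : {linear L -> J}), short_exact f g) ->
  (exists (f : {linear J -> L}) (g : {linear L -> K}), short_exact f g) ->
  loc_regular L s -> loc_regular K s /\ loc_regular J s.
Proof.
case=> f [g fg] [f' [g' fg']]; apply: weakly_regular_periodic;
  try exact: zero_submod.
  exact: short_exact_mod (short_exact_locmod S fg).
exact: short_exact_mod (short_exact_locmod S fg').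
Qed.

Lemma loc_regular_pair (U V : lmodType A) s :
  loc_regular U s -> loc_regular V s -> loc_regular (U * V)%type s.
Proof. exact/loc_regular_middle/short_exact_pair. Qed.

Lemma loc_regular_fst (U V : lmodType A) s :
  loc_regular (U * V)%type s -> loc_regular V s -> loc_regular U s.
Proof. exact/loc_regular_left/short_exact_pair. Qed.

End LocallyRegular.

Section CohenMacaulay.
Variables (R : comPzRingType) (L : lmodType R) (alpha beta : {linear L -> L}).
Hypothesis im_alpha : forall l : L, (exists s, alpha s = l) <-> beta l = 0.
Hypothesis im_beta : forall l : L, (exists s, beta s = l) <-> alpha l = 0.
Variables (x : R) (x_reg : regular_element L x).
Hypothesis beta_Z : forall l : L, beta l \in Zmod x alpha.
Variables (M : submodClosed L) (Z_M : {subset Zmod x alpha <= M}).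

Local Notation Z := (submod (Zmod x alpha)).
Local Notation Z' := (submod (Zmod x beta)).
Local Notation N := (submod (Nmod x alpha beta M)).

(** A sequence regular on [L] is regular on [alpha L] and [beta L], hence on their
    extensions [Z] and [beta L + x L]. If it is also regular on [M], it is regular
    on [M (+) Z], hence on an extension of which [N] is a direct summand. *)
Lemma loc_regular_Z_N (S : mulrClosed R) s :
  loc_regular (S := S) L s -> loc_regular (S := S) (submod M) s ->
  loc_regular (S := S) Z s /\ loc_regular (S := S) N s.
Proof.
move=> rL rM.
have [rK rJ] := loc_regular_periodic (short_exact_KLJ im_alpha)
  (short_exact_KLJ im_beta) rL.
have rZ := loc_regular_middle (short_exact_KZJ im_alpha x_reg) rK rJ.
have rZ' := loc_regular_middle (short_exact_KZJ im_beta x_reg) rJ rK.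
split=> //; apply: (loc_regular_fst _ (loc_regular_pair rL rL)).
apply: (loc_regular_middle _ (loc_regular_pair rM rZ) rZ').
exact: short_exact_MZ_NLL.
Qed.

(** A regular sequence on [L] and one on [M], both as long as the dimension, can be
    replaced by a common one. *)
Lemma cohen_macaulay_Z_N : noetherian R ->
  cohen_macaulay L -> cohen_macaulay (submod M) ->
  cohen_macaulay Z /\ cohen_macaulay N.
Proof.
move=> /noetherian_noeth nR [Lfg cmL] [Mfg cmM].
have [gL gLP] := fg_in_span Lfg; have [gM gMP] := fg_in_span Mfg.
have [gZ gZP] := submod_in_span (Zmod x alpha) nR gLP.
have [gN gNP] := submod_in_span (Nmod x alpha beta M) nR gLP.
suff H (p : primeIdeal R) n : le_krull_dim n (locring (prime_compl p)) ->
    le_depth n (locmod (prime_compl p) Z) /\ le_depth n (locmod (prime_compl p) N).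
  split; first by split=> [|p n /H[]//]; apply: in_span_fg gZP.
  by split=> [|p n /H[]//]; apply: in_span_fg gNP.
move=> dimp; pose S : mulrClosed R := prime_compl p.
have mI := @nonunit_submod_locring R p.
have dL := depth_ge_of_le_depth mI (cmL p n dimp).
have dM := depth_ge_of_le_depth mI (cmM p n dimp).
have [hL hLP] := in_span_locmod S gLP; have [hM hMP] := in_span_locmod S gMP.
have [hZ hZP] := in_span_locmod S gZP; have [hN hNP] := in_span_locmod S gNP.
have [s [sn sN rL rM]] := common_regular_sequence (noeth_locring nR) mI
  (zero_submod _) (zero_submod _) hLP hMP dL dM.
have [rZ rN] := loc_regular_Z_N rL rM.
by split; [apply: le_depth_of_weakly_regular hZP sn sN rZ |
           apply: le_depth_of_weakly_regular hNP sn sN rN].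
Qed.

End CohenMacaulay.

Theorem theorem4p2 (R : comPzRingType) (L : lmodType R)
    (alpha beta : {linear L -> L})
    (im_alpha : forall l : L, (exists s, alpha s = l) <-> beta l = 0)
    (im_beta : forall l : L, (exists s, beta s = l) <-> alpha l = 0)
    (x : R) (x_reg : regular_element L x)
    (beta_Z : forall l : L, beta l \in Zmod x alpha)
    (M : submodClosed L)
    (Z_M : {subset Zmod x alpha <= M}) :
  let Z := submod (Zmod x alpha) in
  let N := submod (Nmod x alpha beta M) in
  [/\ exists (theta : {linear Z -> submod M}) (eta : {linear Z -> Z})
             (f : {linear Z -> (submod M * Z)%type}) (g : {linear (submod M * Z)%type -> N}),
        [/\ forall z : Z, submod_val (theta z) = submod_val z,
            forall (s t : L) (z : Z),
              submod_val z = alpha s + x *: t -> submod_val (eta z) = beta t,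
            forall z : Z, f z = (theta z, eta z),
            forall (m : submod M) (z : Z), submod_val (g (m, z)) = beta (submod_val m) - x *: submod_val z &
            short_exact f g],
      forall (k : fieldType) (iR : {rmorphism k -> R}), injective iR ->
        noetherian R ->
        finitely_generated Z -> finitely_generated (submod M) ->
        (exists n, forall l : L, iter n beta l = 0) ->
        degenerates iR (submod M) N &
      noetherian R -> cohen_macaulay L -> cohen_macaulay (submod M) ->
        cohen_macaulay Z /\ cohen_macaulay N].
Proof.
move=> Z N; split.
- exact: short_exact_Z_MZ_N.
- by move=> k iR _ _; apply: degenerates_M_N.
exact: cohen_macaulay_Z_N.
Qed.
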